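(* Let $W_1:=J\binom{K}{K'}$ and $W_2:=J\binom{L}{L'}$ be two reduced $J$-groups, where $K=(k_1,\dots,k_p)$ and $K'=(k'_1,\dots,k'_p)$ have length $p$ and $L,L'$ have length $q$. \begin{enumerate} \item[(a)] The group $W_1$ is abelian if and only if $p\leqslant 2$, in which case $W_1\cong_{\mathrm{Ref}}J\begin{pmatrix}k_1/k'_1\\1\end{pmatrix}$ if $p=1$, and $W_1\cong_{\mathrm{Ref}}J\begin{pmatrix}k_1/k'_1&k_2/k'_2\\1&1\end{pmatrix}$ if $p=2$. \item[(b)] If $W_1$ and $W_2$ are nonabelian, then $W_1\cong_{\mathrm{Ref}}W_2$ if and only if $p=q$ and there is a permutation $\sigma\in S_p$ such that $\sigma(K)=L$ and $\sigma(K')=L'$. \end{enumerate}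
   Context: For $p\geqslant 1$ and a tuple $K=(k_1,\dots,k_p)$ with entries in $\mathbb{N}_{\geqslant 2}\cup\{\infty\}$, let $J(K)=\langle s_1,\dots,s_p\mid s_1s_2\cdots s_p=s_2\cdots s_ps_1=\cdots=s_ps_1\cdots s_{p-1},\ s_i^{k_i}=1 \text{ for all } i \text{ with } k_i<\infty\rangle$. If $K'=(k'_1,\dots,k'_p)$ are positive integers with $k'_i\mid k_i$ (every positive integer divides $\infty$, and $\infty/k=\infty$), then the generalized $J$-group $J\binom{K}{K'}$ is the normal closure of $\{s_1^{k'_1},\dots,s_p^{k'_p}\}$ in $J(K)$. Its reflections are the conjugates in $J(K)$ of the powers of the $s_i^{k'_i}$ that are different from $1$. The same notation is used by extension when some $k_i=1$ (this may occur in the right-hand sides of (a)), the group being given by the same presentation. A generalized $J$-group $J\binom{K}{K'}$, given with its defining tuples (entries of $K$ being $\geqslant 2$ or $\infty$), is called reduced if $K'$ contains at most two entries distinct from $1$ and the entries of $K'$ are pairwise coprime. The notation $\cong_{\mathrm{Ref}}$ means that there is a group isomorphism mapping the set of reflections of one group bijectively onto that of the other. For $\sigma\in S_p$, $\sigma(K)=(k_{\sigma(1)},\dots,k_{\sigma(p)})$. *)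

(* Defs.v *)
From HB Require Import structures.
From mathcomp Require Import all_boot perm.
From mathcomp Require Import boolp classical_sets functions.

Set Implicit Arguments.
Unset Strict Implicit.
Unset Printing Implicit Defensive.

Local Open Scope classical_set_scope.
Local Open Scope quotient_scope.
Local Open Scope group_scope.

(* MathComp's abstract (possibly infinite) groups come without presentations:
   < I | R > is built here as the quotient of the words over I and its formal
   inverses by the congruence generated by free cancellation and R.
   The letter (i, false) stands for the generator i, (i, true) for i^-1. *)
Section Presentation.
Variable I : choiceType.

Definition word : Type := seq (I * bool).

Definition invl (x : I * bool) : I * bool := (x.1, ~~ x.2).
Definition invw (w : word) : word := rev (map invl w).

Variable R : word -> word -> Prop.

Inductive pres_eq : word -> word -> Prop :=
| pres_refl u : pres_eq u u
| pres_sym u v : pres_eq u v -> pres_eq v u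
| pres_trans u v w : pres_eq u v -> pres_eq v w -> pres_eq u w
| pres_cat u u' v v' :
    pres_eq u u' -> pres_eq v v' -> pres_eq (u ++ v) (u' ++ v')
| pres_cancel x : pres_eq [:: x; invl x] [::]
| pres_relation u v : R u v -> pres_eq u v.

Definition pres_eqb : rel (seq (I * bool)) := fun u v => `[< pres_eq u v >].

Lemma pres_eqb_refl : reflexive pres_eqb.
Proof. by move=> u; apply/asboolP; apply: pres_refl. Qed.

Lemma pres_eqb_sym : symmetric pres_eqb.
Proof. by move=> u v; apply/asboolP/asboolP; apply: pres_sym. Qed.

Lemma pres_eqb_trans : transitive pres_eqb.
Proof.
by move=> v u w /asboolP uv /asboolP vw; apply/asboolP; apply: pres_trans vw.
Qed.

Canonical pres_equiv :=
  EquivRel pres_eqb pres_eqb_refl pres_eqb_sym pres_eqb_trans.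

Definition presented := {eq_quot pres_equiv}.
HB.instance Definition _ := Choice.on presented.

Definition class_of_word (w : word) : presented := \pi_presented w.

Definition pres_mul (x y : presented) : presented :=
  class_of_word (repr x ++ repr y).
Definition pres_one : presented := class_of_word [::].
Definition pres_inv (x : presented) : presented := class_of_word (invw (repr x)).

Lemma class_of_wordP u v : class_of_word u = class_of_word v <-> pres_eq u v.
Proof.
split; first by move/eqmodP/asboolP.
by move=> uv; apply/eqmodP/asboolP.
Qed.

Lemma class_of_wordK (x : presented) : class_of_word (repr x) = x.
Proof. exact: reprK. Qed.

Lemma repr_class_of_word u : pres_eq (repr (class_of_word u)) u.
Proof. by apply/class_of_wordP; rewrite class_of_wordK. Qed.

Lemma pres_mulE u v :
  pres_mul (class_of_word u) (class_of_word v) = class_of_word (u ++ v).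
Proof. by apply/class_of_wordP; apply: pres_cat; apply: repr_class_of_word. Qed.

Lemma invlK : involutive invl.
Proof. by case=> i b; rewrite /invl /= negbK. Qed.

Lemma invwK : involutive invw.
Proof. by move=> w; rewrite /invw map_rev revK mapK //; apply: invlK. Qed.

Lemma pres_mulwV w : pres_eq (w ++ invw w) [::].
Proof.
elim: w => [|x w IHw]; first exact: pres_refl.
have -> : (x :: w) ++ invw (x :: w) = [:: x] ++ ((w ++ invw w) ++ [:: invl x]).
  by rewrite /invw /= rev_cons -cats1 catA.
apply: (@pres_trans _ ([:: x] ++ ([::] ++ [:: invl x]))); last exact: pres_cancel.
apply: pres_cat; first exact: pres_refl.
by apply: pres_cat; [exact: IHw | exact: pres_refl].
Qed.

Lemma pres_mulA : associative pres_mul.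
Proof.
move=> x y z.
rewrite -(class_of_wordK x) -(class_of_wordK y) -(class_of_wordK z).
by rewrite !pres_mulE catA.
Qed.

Lemma pres_mul1 : left_id pres_one pres_mul.
Proof. by move=> x; rewrite -(class_of_wordK x) pres_mulE. Qed.

Lemma pres_mulr1 : right_id pres_one pres_mul.
Proof. by move=> x; rewrite -(class_of_wordK x) pres_mulE cats0. Qed.

Lemma pres_mulrV : right_inverse pres_one pres_inv pres_mul.
Proof.
move=> x; rewrite -{1}(class_of_wordK x) pres_mulE.
by apply/class_of_wordP; apply: pres_mulwV.
Qed.

Lemma pres_mulV : left_inverse pres_one pres_inv pres_mul.
Proof.
move=> x; rewrite -{2}(class_of_wordK x) pres_mulE.
apply/class_of_wordP; rewrite -{2}[repr x]invwK; exact: pres_mulwV.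
Qed.

HB.instance Definition _ :=
  isGroup.Build presented pres_mulA pres_mul1 pres_mulr1 pres_mulV pres_mulrV.

Lemma class_of_wordM u v :
  class_of_word (u ++ v) = class_of_word u * class_of_word v.
Proof. by rewrite -pres_mulE. Qed.

Definition pres_gen (i : I) : presented := class_of_word [:: (i, false)].

End Presentation.

(* The universal property of < I | R >. *)
Section UniversalProperty.
Variables (I : choiceType) (R : word I -> word I -> Prop).
Variables (H : groupType) (h : I -> H).

Definition eval_word (w : word I) : H :=
  \prod_(x <- w) (if x.2 then (h x.1)^-1 else h x.1).

Hypothesis hR : forall u v, R u v -> eval_word u = eval_word v.

Lemma eval_word_pres_eq u v : pres_eq R u v -> eval_word u = eval_word v.
Proof.
elim=> {u v} [//|//|u v w _ -> _ -> //|u u' v v' _ Eu _ Ev|[i b]|u v].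
- by move: Eu Ev; rewrite /eval_word !big_cat /= => -> ->.
- by rewrite /eval_word !big_cons !big_nil mulg1 /=; case: b;
    rewrite /= ?mulVg ?mulgV.
- exact: hR.
Qed.

Lemma presentedP : exists! f : presented R -> H,
  {morph f : x y / x * y} /\ forall i, f (pres_gen R i) = h i.
Proof.
have ecw u : eval_word (repr (class_of_word R u)) = eval_word u.
  by apply: eval_word_pres_eq; apply: repr_class_of_word.
exists (fun x => eval_word (repr x)); split.
  split=> [x y|i]; last by rewrite ecw /eval_word big_seq1.
  by rewrite -{1}(class_of_wordK x) -{1}(class_of_wordK y) -class_of_wordM ecw
    /eval_word big_cat.
move=> f [fM fg]; apply/funext => x; rewrite -[in RHS](class_of_wordK x).
have f1 : f 1 = 1 by apply: (mulgI (f 1)); rewrite -fM !mulg1.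
elim: (repr x) => [|[i b] w IHw]; first by rewrite /eval_word big_nil -f1.
rewrite -cat1s class_of_wordM fM -IHw /eval_word big_cat big_seq1 /=.
congr (_ * _); case: b => /=; rewrite -fg //; apply: (mulgI (f (pres_gen R i))).
rewrite mulgV -fM -f1 -class_of_wordM; congr f.
by apply/class_of_wordP/pres_sym; apply: pres_cancel.
Qed.

End UniversalProperty.

Section NormalClosure.
Variable G : groupType.

Definition normal_subgroup (H : set G) : Prop :=
  [/\ H 1, forall x y, H x -> H y -> H (x * y), forall x, H x -> H x^-1
    & forall x g, H x -> H (x ^ g)].

Definition normal_closure (A : set G) : set G := smallest normal_subgroup A.

Definition powers (x : G) : set G :=
  [set y | exists n : nat, y = x ^+ n \/ y = x ^- n].

End NormalClosure.

(* Elements of N u {oo}, with None for oo. *)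
Notation natoo := (option nat).

Definition geq2oo (k : natoo) : bool := if k is Some n then (1 < n)%N else true.
Definition dvdoo (d : nat) (k : natoo) : bool :=
  if k is Some n then (d %| n)%N else true.
Definition divoo (k : natoo) (d : nat) : natoo := omap (fun n => (n %/ d)%N) k.

Section JGroups.
Variable p : nat.
Implicit Type K : p.-tuple natoo.

Definition cyc_word : word 'I_p := [seq (i, false) | i <- enum 'I_p].

Inductive J_rel K : word 'I_p -> word 'I_p -> Prop :=
| J_rotation i : (i < p)%N -> J_rel K cyc_word (rot i cyc_word)
| J_torsion i k : tnth K i = Some k -> J_rel K (nseq k (i, false)) [::].

Definition J K : groupType := presented (J_rel K).

Definition J_gen K (i : 'I_p) : J K := pres_gen (J_rel K) i.

Definition generalized_J K (K' : p.-tuple nat) : set (J K) :=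
  normal_closure [set J_gen K i ^+ tnth K' i | i in [set: 'I_p]].
Arguments generalized_J : clear implicits.

Definition reflections K (K' : p.-tuple nat) : set (J K) :=
  [set r | exists i t g,
     [/\ powers (J_gen K i ^+ tnth K' i) t, t <> 1 & r = t ^ g]].
Arguments reflections : clear implicits.

Definition abelian_J K (K' : p.-tuple nat) : Prop :=
  forall x y, generalized_J K K' x -> generalized_J K K' y -> commute x y.

Definition defining_tuples K (K' : p.-tuple nat) : Prop :=
  (0 < p)%N /\
  forall i, [/\ geq2oo (tnth K i), (0 < tnth K' i)%N
              & dvdoo (tnth K' i) (tnth K i)].

Definition reduced K (K' : p.-tuple nat) : Prop :=
  [/\ defining_tuples K K', (count (fun k' => k' != 1) K' <= 2)%N
    & forall i j : 'I_p, i != j -> coprime (tnth K' i) (tnth K' j)].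

Definition permt (T : Type) (s : 'S_p) (t : p.-tuple T) : p.-tuple T :=
  [tuple tnth t (s i) | i < p].

End JGroups.

Arguments generalized_J {p} K K'.
Arguments reflections {p} K K'.


(* A homomorphism between the subgroups is represented by a function on the
   ambient groups; its values outside generalized_J K K' are irrelevant. *)
Definition ref_iso p q (K : p.-tuple natoo) (K' : p.-tuple nat)
    (L : q.-tuple natoo) (L' : q.-tuple nat) : Prop :=
  exists f : J K -> J L,
    [/\ forall x y, generalized_J K K' x -> generalized_J K K' y ->
          f (x * y) = f x * f y,
        set_bij (generalized_J K K') (generalized_J L L') f
      & f @` reflections K K' = reflections L L'].

(* Main.v *)
Require Import Defs.
From mathcomp Require Import all_boot perm.
From HB Require Import structures.
From mathcomp Require Import all_order all_algebra all_fingroup cyclic center.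
From mathcomp Require Import finfield mxabelem mxrepresentation ring.

(* Since at most two entries of K' differ from 1 and these are coprime,
   J(K) = W <z> with z = s_1 ... s_p central.  Hence W and J(K) have the same commutators, and a homomorphism
   from W killing its center extends to J(K) by z |-> 1, that is, to a tuple
   (x_i) with x_i ^ k_i = 1 and product 1.

   Let f be a reflection isomorphism.  The images of the r_i = s_i ^ k'_i in
   the abelianization show that f matches the nontrivial r_i with generators
   r'_j of the same order, up to conjugation and powers.  Killing powers of
   matched reflections on both sides gives quotients in which all orders k_i
   are finite, and f still identifies the central quotients, which are
   orbifold groups <x_i | x_i ^ k_i = prod x_i = 1>.  To recover the
   multiset {k_i}, take a finite quotient Q in which the x_i have exact order
   k_i (realized by 2 x 2 reflections over a finite field modulo scalars).
   For a semisimple Q-module V, the homomorphisms to V x| Q lifting the given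
   one form a space of dimension sum_i rank (1 - x_i) minus the dimension of
   the span of the images of the 1 - x_i (Weil).  Hence sum_i rank (1 - x_i)
   on V depends only on W.  Letting V run over the permutation modules F[C\Q]
   with C cyclic, Burnside's lemma yields the sums of 1/k_i over the i such that m
   divides k_i, for each m > 1, and these determine the multiset.  Comparing
   the orders before and after killing one matched class of reflections
   gives k'_i for this class.

   Conversely, Hurwitz moves realize the permutations of the generators. *)

Set Implicit Arguments.
Unset Strict Implicit.
Unset Printing Implicit Defensive.


(** * Triples of complex reflections over a finite field *)

Section ReflectionMatrices.
Import GRing.Theory.
Local Open Scope ring_scope.

(** A reflection isomorphism is defined on [W] only, while some generators of [J K] may lie outside
    [W]. Moreover it respects the center of [W], but a priori not the intersection of [W] with the
    powers of [z]. So only homomorphisms that kill the whole center of [W] are transferred. For a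
    lift to the affine group this property is not automatic; it holds because the orders involved
    are invertible in the field.

    Exact orders in a finite quotient require at least three nontrivial [k_i]: with two of them the
    orbifold group is cyclic and sees only their gcd. Killing one class leaves just two nontrivial
    orders exactly when [p = 3] and [k'_i = 1]. The number of nontrivial orders recognizes this case
    on both sides.

    A transferred tuple is only known to have orders dividing the expected ones; equality comes from
    using both directions and comparing sums. Finally, an index with [k_i = k'_i] has [r_i = 1] and
    is invisible to the matching. Such indices are what remains of the multiset of orders once the
    matched ones are removed. *)

Lemma finField_prim_root M : (0 < M)%N ->
  exists (F : finFieldType) (w : F), M.-primitive_root w.
Proof.
move=> M_gt0; pose l := s2val (prime_above M).
have lM : (M < l)%N := s2valP (prime_above M).
have l_pr : prime l := s2valP' (prime_above M).
have tM_gt0 : (0 < totient M)%N by rewrite totient_gt0.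
(* The prime [l > M] is coprime to [M], so by Euler [M] divides [l ^ totient M - 1], the order of
   the multiplicative group of [F]. *)
have [F _ cardF] := PrimePowerField l_pr tM_gt0.
have F_gt1 : (0 < #|F|.-1)%N by rewrite -ltnS prednK ?finRing_gt1
  ?finRing_card_gt0 // ltnW ?finRing_gt1.
pose rs := enum [pred x : F | x != 0].
have rs_size : size rs = #|F|.-1 by rewrite -cardE -(cardC1 0).
have: has #|F|.-1.-primitive_root rs.
  apply: has_prim_root => //; rewrite ?enum_uniq ?rs_size //.
  apply/allP=> x; rewrite mem_enum inE => x0; rewrite unity_rootE.
  by rewrite -(inj_eq (mulfI x0)) -exprS prednK ?expf_card ?mulr1 // ltnW
    ?finRing_gt1.
case/hasP=> w _ w_prim; exists F, (w ^+ (#|F|.-1 %/ M)).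
apply: (dvdn_prim_root w_prim).
have cMl : coprime l M by rewrite prime_coprime // gtnNdvd.
have := Euler_exp_totient cMl; rewrite -cardF => /eqP.
by rewrite eqn_mod_dvd ?subn1 // ltnW ?finRing_gt1.
Qed.

Variable F : fieldType.

Definition mx2 (a b c d : F) : 'M[F]_2 :=
  \matrix_(i, j) if i == 0 then (if j == 0 then a else b)
                 else (if j == 0 then c else d).

Lemma mx2E (X : 'M[F]_2) : X = mx2 (X 0 0) (X 0 1) (X 1 0) (X 1 1).
Proof.
by apply/matrixP=> i j; rewrite !mxE; case: i j => -[|[|//]] ? [[|[|//]] ?] /=;
  congr (X _ _); apply/val_inj.
Qed.

Lemma mx2_inj a b c d a' b' c' d' :
  mx2 a b c d = mx2 a' b' c' d' -> [/\ a = a', b = b', c = c' & d = d'].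
Proof.
move/matrixP=> E; split.
- by have := E 0 0; rewrite !mxE.
- by have := E 0 1; rewrite !mxE.
- by have := E 1 0; rewrite !mxE.
- by have := E 1 1; rewrite !mxE.
Qed.

Lemma mx2M a b c d a' b' c' d' : mx2 a b c d * mx2 a' b' c' d' =
  mx2 (a * a' + b * c') (a * b' + b * d') (c * a' + d * c') (c * b' + d * d').
Proof.
apply/matrixP=> i j; rewrite !mxE !big_ord_recl big_ord0 addr0 !mxE /=.
by case: (i == 0); case: (j == 0).
Qed.

Lemma mx2D a b c d a' b' c' d' : mx2 a b c d + mx2 a' b' c' d' =
  mx2 (a + a') (b + b') (c + c') (d + d').
Proof.
by apply/matrixP=> i j; rewrite !mxE; case: (i == 0); case: (j == 0).
Qed.

Lemma mx2Z k a b c d : k *: mx2 a b c d = mx2 (k * a) (k * b) (k * c) (k * d).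
Proof.
by apply/matrixP=> i j; rewrite !mxE; case: (i == 0); case: (j == 0).
Qed.

Lemma mx2_scalar a : a%:M = mx2 a 0 0 a.
Proof.
apply/matrixP=> i j; rewrite !mxE.
by case: i j => -[|[|//]] ? [[|[|//]] ?] /=; rewrite ?mulr1n ?mulr0n.
Qed.

Lemma det_mx2 a b c d : \det (mx2 a b c d) = a * d - b * c.
Proof.
rewrite (expand_det_row _ 0) !big_ord_recl big_ord0 addr0 /cofactor !det_mx11.
by rewrite !mxE /= expr0 expr1; ring.
Qed.

(* [x] has eigenvalues 1 and [z]. *)
Definition is_refl (z : F) (x : 'M[F]_2) := \det x = z /\ \tr x = 1 + z.

Lemma tr_mx2 a b c d : \tr (mx2 a b c d) = a + d.
Proof. by rewrite /mxtrace !big_ord_recl big_ord0 addr0 !mxE. Qed.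

Lemma is_refl_mx2 a b c d z :
  a * d - b * c = z -> a + d = 1 + z -> is_refl z (mx2 a b c d).
Proof. by move=> dz tz; split; rewrite ?det_mx2 ?tr_mx2. Qed.

Lemma is_refl_sqr z x : is_refl z x -> x * x = (1 + z) *: x - z%:M.
Proof.
rewrite (mx2E x) => -[]; rewrite det_mx2 tr_mx2 => <- tz.
rewrite -tz -scaleN1r mx2_scalar mx2M !mx2Z mx2D.
by congr mx2; ring.
Qed.

(** Since [x * (x - 1) = z *: (x - 1)] by Cayley-Hamilton, successive powers differ by
    [x ^+ n.+1 - x ^+ n = z ^+ n *: (x - 1)]. *)
Lemma is_refl_exp z x n : is_refl z x ->
  x ^+ n = 1 + (\sum_(i < n) z ^+ i) *: (x - 1).
Proof.
move=> /is_refl_sqr xx; elim: n => [|n IHn].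
  by rewrite expr0 big_ord0 scale0r addr0.
rewrite exprSr IHn mulrDl mul1r -scalerAl mulrBl mul1r xx big_ord_recl expr0.
have -> : \sum_(i < n) z ^+ bump 0 i = z * \sum_(i < n) z ^+ i.
  by rewrite mulr_sumr; apply: eq_bigr => i _; rewrite exprS.
set S := \sum_(i < n) z ^+ i.
have -> : (1 + z) *: x - z%:M - x = z *: (x - 1).
  by rewrite scalerBr scalerDl scale1r [_ + z *: x]addrC -scalemx1 addrAC addrK.
by rewrite scalerA [S * z]mulrC scalerDl scale1r addrA [1 + (x - 1)]addrC subrK.
Qed.

(** For [z = 1] the matrix may be a transvection, whose order is the characteristic. *)
Lemma is_refl_order z x n : is_refl z x -> z != 1 -> z ^+ n = 1 -> x ^+ n = 1.
Proof.
move=> xz z1 zn; rewrite (is_refl_exp _ xz).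
have : (z - 1) * \sum_(i < n) z ^+ i = 0 by rewrite -subrX1 zn subrr.
by move/eqP; rewrite mulf_eq0 subr_eq0 (negPf z1) => /eqP ->; rewrite scale0r addr0.
Qed.

(** The eigenvalue 1 of [x] forces [m = 1], and then the determinant gives [z ^+ n = 1]. So modulo
    scalars the order of [x] is still a multiple of that of [z]. *)
Lemma is_refl_scalar z x n m : is_refl z x -> x ^+ n = m%:M -> z ^+ n = 1.
Proof.
move=> xz xn; have [detx _] := xz.
suff m1 : m = 1.
  have := congr1 determinant xn; rewrite det_scalar m1 expr1n.
  suff -> : \det (x ^+ n) = z ^+ n by [].
  elim: n {xn} => [|n IHn]; first by rewrite det1.
  by rewrite !exprS -IHn -detx -det_mulmx.
move: xn; rewrite (is_refl_exp _ xz); set c := \sum_(i < n) _.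
case: xz detx => _; rewrite (mx2E x).
move: (x 0 0) (x 0 1) (x 1 0) (x 1 1) => a b e d.
rewrite tr_mx2 det_mx2 => trx detx.
rewrite -[1]/(1%:M) -scaleN1r !mx2_scalar !(mx2Z, mx2D).
move=> /mx2_inj[E1 E2 E3 E4].
(* This is the determinant of [x - 1]. As [x ^+ n - 1] is both scalar and a multiple of [x - 1], the
   square of [m - 1] vanishes with it. *)
have det1 : (a - 1) * (d - 1) - b * e = 0.
  have -> : (a - 1) * (d - 1) - b * e = (a * d - b * e) - (a + d) + 1 by ring.
  by rewrite detx trx; ring.
have : (m - 1) ^+ 2 = c ^+ 2 * ((a - 1) * (d - 1) - b * e).
  have F1 : m - 1 = c * (a - 1) by rewrite -E1; ring.
  have F2 : c * b = 0 by rewrite -[RHS]E2; ring.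
  have F4 : m - 1 = c * (d - 1) by rewrite -E4; ring.
  by rewrite expr2 {1}F1 F4 -[LHS]subr0 -(mul0r (c * e)) -F2; ring.
move/eqP; rewrite det1 mulr0 expf_eq0 subr_eq0 => /eqP //.
Qed.

End ReflectionMatrices.

Section ReflectionTuples.
Import GRing.Theory.
Local Open Scope ring_scope.

(** The product being scalar, [x c] is [l] times the inverse of the product of the others, and only
    its determinant and trace have to be arranged: the choice of [l ^+ 2] settles the first, a free
    entry [t] of [x b] the second. The other nontrivial matrices are diagonal and stand between [b]
    and [c]. *)
Lemma reflection_matrices p (k : nat -> nat) a b c :
  (forall n, 0 < k n)%N -> (a < b)%N -> (b < c)%N -> (c < p)%N ->
  (1 < k a)%N -> (1 < k b)%N -> (1 < k c)%N ->
  (forall n, (1 < k n)%N -> (n == a) || (b <= n <= c)%N) ->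
  exists (F : finFieldType) (z : nat -> F) (x : nat -> 'M[F]_2) (l : F),
  [/\ forall n, (k n).-primitive_root (z n),
      forall n, is_refl (z n) (x n),
      forall n, k n = 1%N -> x n = 1,
      \prod_(0 <= n < p) x n = l%:M
    & forall X, X * x a = x a * X -> X * x b = x b * X -> exists m, X = m%:M].
Proof.
move=> k_gt0 ab bc cp ka kb kc kout.
pose M := (\prod_(0 <= n < p) k n)%N.
have M_gt0 : (0 < M)%N by rewrite prodn_gt0.
have kM n : (k n %| M)%N.
  have [np|pn] := ltnP n p.
    by rewrite /M big_mkord (bigD1 (Ordinal np)) //= dvdn_mulr.
  suff -> : k n = 1%N by rewrite dvd1n.
  apply/eqP; rewrite eqn_leq k_gt0 andbT leqNgt; apply/negP => /kout.
  rewrite [(n <= c)%N]leqNgt (leq_trans cp pn) andbF orbF => /eqP na.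
  by have := ltn_trans ab (ltn_trans bc cp); rewrite -na ltnNge pn.
have M2_gt0 : (0 < 2 * M)%N by rewrite muln_gt0.
have [F [w w_prim]] := finField_prim_root M2_gt0.
(* The determinant of the product is the square of [l], so square roots [e n] of the eigenvalues
   [z n] are needed; hence the order [2 * M] of [w]. *)
pose e n := w ^+ (M %/ k n); pose z n := e n ^+ 2.
have z_prim n : (k n).-primitive_root (z n).
  rewrite /z /e -exprM mulnC muln_divA //.
  by apply: (dvdn_prim_root w_prim); rewrite dvdn_mull.
have z0 n : z n != 0.
  apply/eqP=> z0; have := prim_expr_order (z_prim n).
  by rewrite z0 expr0n gtn_eqF // => /esym/eqP; rewrite oner_eq0.
have z1 n : k n = 1%N -> z n = 1 by move=> kn;
  have := prim_expr_order (z_prim n); rewrite kn.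
have zN1 n : (1 < k n)%N -> z n != 1.
  by rewrite -(expr1 (z n)) -(prim_order_dvd (z_prim n)) dvdn1 => /gtn_eqF ->.
pose D y : 'M[F]_2 := mx2 y 0 0 1.
have D1 : D 1 = 1 by rewrite /D -mx2_scalar.
have DM : {morph D : u v / u * v}.
  by move=> u v; rewrite /D mx2M; congr mx2; ring.
pose d := \prod_(b.+1 <= n < c) z n.
have d0 : d != 0 by rewrite /d prodf_seq_neq0; apply/allP=> n _; apply: z0.
pose l := e a * e b * \prod_(b.+1 <= n < c) e n * e c.
have l2 : l ^+ 2 = z a * z b * d * z c.
  by rewrite /l /d !exprMn -prodrXl.
(* [A * B * D d] is [mx2 m1 (z b) m3 (z b)], of determinant [d * z a * z b], and [C] is [l] times
   its inverse. This [t] is the solution of the equation saying that [C] has trace [1 + z c]. *)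
pose t := (l * (1 + (z c)^-1) - z b) / d - z a.
pose A := mx2 (z a) 1 0 1.
pose B := mx2 1 0 t (z b).
pose m1 := (z a + t) * d; pose m3 := t * d.
pose s := l / (d * z a * z b).
pose C := mx2 (s * z b) (- s * z b) (- s * m3) (s * m1).
pose x n := if n == a then A else if n == b then B else if n == c then C else D
  (z n).
have tE : m1 + z b = l * (1 + (z c)^-1).
  by rewrite /m1 /t; field; rewrite !z0 d0.
have sc : s * s * (d * z a * z b) = z c.
  have -> : s * s * (d * z a * z b) = l ^+ 2 / (d * z a * z b).
    by rewrite /s; field; rewrite !z0 d0.
  by rewrite l2; field; rewrite !z0 d0.
have trivx n : (k n = 1)%N -> x n = 1.
  move=> kn; rewrite /x; have [na|_] := eqVneq; first by rewrite -na kn in ka.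
  have [nb|_] := eqVneq; first by rewrite -nb kn in kb.
  have [nc|_] := eqVneq; first by rewrite -nc kn in kc.
  by rewrite z1 ?D1.
have k1 n : ~~ ((n == a) || (b <= n <= c)%N) -> k n = 1%N.
  by move=> out; apply/eqP; rewrite eqn_leq k_gt0 andbT leqNgt;
    apply: contra out; apply: kout.
exists F, z, x, l; split=> //.
- move=> n; rewrite /x; have [->|_] := eqVneq; first by apply: is_refl_mx2; ring.
  have [->|_] := eqVneq; first by apply: is_refl_mx2; ring.
  have [->|_] := eqVneq; last by apply: is_refl_mx2; ring.
  apply: is_refl_mx2.
    rewrite -sc /m1 /m3; ring.
  have -> : s * z b + s * m1 = s * (m1 + z b) by ring.
  rewrite tE.
  have -> : s * (l * (1 + (z c)^-1)) = l ^+ 2 / (d * z a * z b) * (1 + (z c)^-1).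
    by rewrite /s; field; rewrite !z0 d0.
  by rewrite l2; field; rewrite !z0 d0.
- have triv i j : (forall n, (i <= n < j)%N -> k n = 1%N) -> \prod_(i <= n < j)
  x n = 1.
    by move=> kij; rewrite big_seq_cond big1_seq // => n /andP[_];
      rewrite mem_index_iota => /kij/trivx.
  have ap : (a < p)%N by rewrite (ltn_trans ab) // (ltn_trans bc).
  rewrite (big_cat_nat (n := a)) ?(ltnW ap) //= (triv 0%N); last first.
    by move=> n /andP[_ na]; apply: k1;
      rewrite (ltn_eqF na) /= leqNgt (ltn_trans na ab).
  rewrite (big_ltn ap) (big_cat_nat (n := b)) ?(ltnW (ltn_trans bc cp)) //=
    (triv a.+1); last first.
    by move=> n /andP[an nb]; apply: k1; rewrite (gtn_eqF an) /= leqNgt nb.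
  rewrite (big_ltn (ltn_trans bc cp)) (big_cat_nat (n := c)) ?(ltnW cp) //=.
  rewrite (big_ltn cp) (triv c.+1); last first.
    move=> n /andP[cn _]; apply: k1;
      rewrite (gtn_eqF (ltn_trans (ltn_trans ab bc) cn)) /=.
    by rewrite [(n <= c)%N]leqNgt cn andbF.
  rewrite !mul1r mulr1.
  have -> : \prod_(b.+1 <= n < c) x n = D d.
    rewrite /d (big_morph D DM D1) !big_seq; apply: eq_bigr => n.
    rewrite mem_index_iota => /andP[bn nc]; rewrite /x.
    by rewrite (gtn_eqF (ltn_trans ab bn)) (gtn_eqF bn) (ltn_eqF nc).
  rewrite /x !eqxx (gtn_eqF ab) (gtn_eqF bc) (gtn_eqF (ltn_trans ab bc)).
  rewrite /A /B /C /D !mx2M mx2_scalar /m1 /m3.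
  have sE : s * (d * z a * z b) = l by rewrite /s; field; rewrite !z0 d0.
  by rewrite -sE; congr mx2; ring.
(* Commuting with [A] makes [X] upper triangular. As [z b != 1], commuting with [B] makes it
   diagonal, and then [A] makes it scalar. *)
- rewrite /x !eqxx (gtn_eqF ab) => X; rewrite (mx2E X).
  move: (X 0 0) (X 0 1) (X 1 0) (X 1 1) => x1 x2 x3 x4.
  rewrite /A /B !mx2M => /mx2_inj[A1 A2 A3 A4] /mx2_inj[B1 B2 B3 B4].
  have x3_0 : x3 = 0.
    have -> : x3 = (z a * x1 + 1 * x3) - (x1 * z a + x2 * 0) by ring.
    by rewrite A1 subrr.
  have x2_0 : x2 = 0.
    have: x2 * (z b - 1) = 0.
      have -> : x2 * (z b - 1) = (x1 * 0 + x2 * z b) - (1 * x2 + 0 * x4) by ring.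
      by rewrite B2 subrr.
    by move/eqP; rewrite mulf_eq0 subr_eq0 (negPf (zN1 _ kb)) orbF => /eqP.
  exists x1; rewrite mx2_scalar x2_0 x3_0; congr mx2.
  move: A2; rewrite x2_0 !mulr0 !mul1r !mulr1 addr0 add0r => //.
Qed.

Local Open Scope group_scope.

(** Modulo its center, the group generated by the [x i] is a finite quotient of the orbifold group
    in which every generator has its exact order [k i]. *)
Lemma reflection_rep p (k : 'I_p -> nat) :
  (forall i, 0 < k i)%N -> (2 < #|[set i | 1 < k i]|)%N ->
  exists (gT : finGroupType) (x : 'I_p -> gT),
  [/\ forall i, x i ^+ k i = 1,
      forall i, commute (\prod_(j < p) x j) (x i)
    & forall i n, (forall j, commute (x i ^+ n) (x j)) -> (k i %| n)%N].
Proof.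
move=> k_gt0 k3.
pose kn n := oapp k 1%N (insub n : option 'I_p).
have knE (i : 'I_p) : kn i = k i by rewrite /kn valK.
have kn_gt0 n : (0 < kn n)%N by rewrite /kn; case: insub => [i|] //=.
pose P n := (1 < kn n)%N.
have Pp n : P n -> (n < p)%N by rewrite /P /kn; case: insubP => [i + _ _|].
have exP : exists n, P n.
  case/card_gt0P: (ltn_trans (ltn_trans (ltn0Sn 0) (ltnSn 1)) k3) => i.
  by rewrite inE -knE => Pi; exists i.
have ubP n : P n -> (n <= p)%N by move/Pp/ltnW.
case: (ex_minnP exP) => a Pa a_min; case: (ex_maxnP exP ubP) => c Pc c_max.
(* With [a] least, [c] greatest and [b] second least, every nontrivial index is [a] or lies between
   [b] and [c]. *)
have exPb : exists n, P n && (a < n < c)%N.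
  have: ~~ ([set i | (1 < k i)%N] \subset [set Ordinal (Pp _ Pa);
    Ordinal (Pp _ Pc)]).
    apply: contraL k3 => /subset_leq_card kac.
    by rewrite -leqNgt (leq_trans kac) // cards2; case: (_ != _).
  case/subsetPn=> i; rewrite !inE -knE -!val_eqE /= => Pi /norP[ia ic].
  by exists i; rewrite /P Pi !ltn_neqAle eq_sym ia ic a_min ?c_max.
case: (ex_minnP exPb) => b /andP[Pb /andP[ab bc]] b_min.
have kout n : (1 < kn n)%N -> (n == a) || (b <= n <= c)%N.
  move=> Pn; have [//|na /=] := eqVneq n a; rewrite c_max // andbT.
  have an : (a < n)%N by rewrite ltn_neqAle eq_sym na a_min.
  have := c_max _ Pn; rewrite leq_eqVlt => /orP[/eqP ->|nc]; first exact: ltnW.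
  by apply: b_min; rewrite /P Pn an nc.
have [F [z [x [l [z_prim x_refl x1 prod_x x_comm]]]]] :=
  reflection_matrices kn_gt0 ab bc (Pp _ Pc) Pa Pb Pc kout.
have Ux n : x n \is a GRing.unit.
  rewrite unitmxE (x_refl n).1 GRing.unitfE; apply/eqP=> z0.
  have := prim_expr_order (z_prim n).
  by rewrite z0 GRing.expr0n gtn_eqF // => /esym/eqP; rewrite GRing.oner_eq0.
exists {unit 'M[F]_2}, (fun i => FinRing.unit _ (Ux i)); split.
- move=> i; apply: val_inj; rewrite FinRing.val_unitX /= -knE.
  have [k1|k1] := eqVneq (kn i) 1%N; first by rewrite k1 x1.
  apply: is_refl_order (x_refl i) _ (prim_expr_order (z_prim i)).
  by rewrite -[z i]GRing.expr1 -(prim_order_dvd (z_prim i)) dvdn1.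
- have prodE : val (\prod_(j < p) (FinRing.unit _ (Ux j) : {unit 'M[F]_2}))
      = (\prod_(j < p) x j)%R.
    by apply: (big_morph val).
  move=> i; apply: val_inj; rewrite !FinRing.val_unitM prodE /=.
  by rewrite -(big_mkord xpredT x) prod_x; apply/esym/scalar_mxC.
- move=> i n xC; rewrite -knE (prim_order_dvd (z_prim i)); apply/eqP.
  have xC' (j : 'I_p) : (x i ^+ n * x j = x j * x i ^+ n)%R.
    by have := congr1 val (xC j); rewrite !FinRing.val_unitM FinRing.val_unitX.
  have [m xn] := x_comm _ (xC' (Ordinal (Pp _ Pa))) (xC' (Ordinal (Pp _ Pb))).
  exact: is_refl_scalar (x_refl i) xn.
Qed.

End ReflectionTuples.

(** * Affine lifts of a finite group *)

Section AdditiveFibers.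
Import GRing.Theory.
Local Open Scope ring_scope.

Lemma card_ffun_additive_fibers (I : finType) (T V : finZmodType) (D : {set
  {ffun I -> T}})
    (h : {ffun I -> T} -> V) :
  {in D &, forall u v, u - v \in D} -> {in D &, {morph h : u v / u - v}} ->
  #|D| = (#|[set u in D | h u == 0%R]| * #|h @: D|)%N.
Proof.
move=> DB hB.
have D0 u : u \in D -> 0 \in D by move=> Du; rewrite -(subrr u) DB.
have h0 u : u \in D -> h 0 = 0 by move=> Du; rewrite -(subrr u) hB // subrr.
have DN u : u \in D -> - u \in D by move=> Du; rewrite -sub0r DB // (D0 u).
have hN u : u \in D -> h (- u) = - h u.
  by move=> Du; rewrite -sub0r hB ?(D0 u) // (h0 u) // sub0r.
rewrite -sum1_card (partition_big_imset h) /= mulnC -sum_nat_const.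
apply: eq_bigr => _ /imsetP[u Du ->]; rewrite sum1_card.
rewrite -(card_imset [in [set v in D | h v == 0]] (addrI u)); apply: eq_card => v.
rewrite unfold_in; apply/andP/imsetP=> [[Dv /eqP hv]|[w + ->]].
  exists (v - u); last by rewrite addrC subrK.
  by rewrite inE DB // hB // hv subrr eqxx.
rewrite inE => /andP[Dw /eqP hw]; have ->: u + w = u - - w by rewrite opprK.
by rewrite DB ?DN // hB ?DN // hN // hw oppr0 subr0.
Qed.

End AdditiveFibers.

Section AffineGroup.
Import GRing.Theory.
Variables (F : finFieldType) (qT : finGroupType) (N : nat).

(** The semidirect product of the row module [rG] by [qT]. The carrier does not involve [rG]; it is
    a parameter of the alias so that the group law may depend on it. *)
Definition affine (rG : mx_representation F [set: qT] N) : Type :=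
  ('rV[F]_N * qT)%type.
HB.instance Definition _ rG := Choice.copy (affine rG) ('rV[F]_N * qT)%type.

Variable rG : mx_representation F [set: qT] N.

Implicit Types x y : affine rG.

Lemma rGM (a b : qT) : rG (a * b)%g = (rG a *m rG b)%R.
Proof. by rewrite repr_mxM ?inE. Qed.

Lemma rG1 : rG 1%g = 1%:M%R.
Proof. exact: repr_mx1. Qed.

Definition affine_mul x y : affine rG := ((x.1 *m rG y.2 + y.1)%R, (x.2 * y.2)%g).
Definition affine_one : affine rG := (0%R, 1%g).
Definition affine_inv x : affine rG := ((- (x.1 *m rG (x.2^-1)%g))%R, (x.2^-1)%g).

Lemma affine_mulA : associative affine_mul.
Proof.
move=> [v a] [w b] [u c]; congr pair; rewrite /= ?mulgA //.
by rewrite rGM mulmxDl mulmxA addrA.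
Qed.

Lemma affine_mul1 : left_id affine_one affine_mul.
Proof. by move=> [v a]; congr pair; rewrite /= ?mul1g // mul0mx add0r. Qed.

Lemma affine_mulr1 : right_id affine_one affine_mul.
Proof. by move=> [v a]; congr pair; rewrite /= ?mulg1 // rG1 mulmx1 addr0. Qed.

Lemma affine_mulV : left_inverse affine_one affine_inv affine_mul.
Proof.
move=> [v a]; congr pair; rewrite /= ?mulVg //.
by rewrite mulNmx -mulmxA -rGM mulVg rG1 mulmx1 addNr.
Qed.

Lemma affine_mulrV : right_inverse affine_one affine_inv affine_mul.
Proof. by move=> [v a]; congr pair; rewrite /= ?mulgV // subrr. Qed.

HB.instance Definition _ := isGroup.Build (affine rG)
  affine_mulA affine_mul1 affine_mulr1 affine_mulV affine_mulrV.

Local Notation S a := (1%:M - rG a)%R.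

Lemma affine_mulE x y :
  (x * y)%g = ((x.1 *m rG y.2 + y.1)%R, (x.2 * y.2)%g) :> affine rG.
Proof. by []. Qed.

Lemma affine_snd_morph : {morph (snd : affine rG -> qT) : x y / (x * y)%g}.
Proof. by []. Qed.

Local Open Scope ring_scope.

Lemma affine_exp (v : 'rV[F]_N) (a : qT) n :
  (((v, a) : affine rG) ^+ n)%g = (v *m \sum_(j < n) rG (a ^+ j)%g, (a ^+ n)%g)
    :> affine rG.
Proof.
elim: n => [|n IHn]; first by rewrite big_ord0 mulmx0.
rewrite expgS IHn affine_mulE /= -expgS; congr pair.
by rewrite big_ord_recr /= mulmxDr addrC.
Qed.

Lemma sub1_rG_exp (a : qT) n :
  S (a ^+ n)%g = (\sum_(j < n) rG (a ^+ j)%g) *m S a.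
Proof.
elim: n => [|n IHn]; first by rewrite big_ord0 mul0mx rG1 subrr.
rewrite big_ord_recr /= mulmxDl -IHn expgSr rGM mulmxBr mulmx1.
by rewrite addrA subrK.
Qed.

Lemma rG_exp_comm (a : qT) n :
  (\sum_(j < n) rG (a ^+ j)%g) *m S a = S a *m (\sum_(j < n) rG (a ^+ j)%g).
Proof.
rewrite mulmx_suml mulmx_sumr; apply: eq_bigr => j _.
by rewrite mulmxBr mulmxBl mulmx1 mul1mx -!rGM -expgS -expgSr.
Qed.

(** For [n] invertible, the kernel of the norm [1 + a + ... + a ^+ n.-1] is exactly the image of
    [1 - a]: a vector of norm 0 is the average over [j] of its images under [1 - a ^+ j]. *)
Lemma affine_exp_eq1 (v : 'rV[F]_N) (a : qT) n :
  (a ^+ n = 1)%g -> n%:R != 0 :> F ->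
  (((v, a) : affine rG) ^+ n == 1)%g = (v <= S a)%MS.
Proof.
move=> an n0; rewrite affine_exp an xpair_eqE eqxx andbT.
apply/eqP/idP=> [vN|/submxP[w ->]]; last first.
  by rewrite -mulmxA -rG_exp_comm -sub1_rG_exp an rG1 subrr mulmx0.
have -> : v = n%:R^-1 *: (v *m \sum_(j < n) S (a ^+ j)%g).
  rewrite sumrB mulmxBr vN subr0 sumr_const card_ord -scaler_nat -scalemxAr mulmx1.
  by rewrite scalerA mulVf // scale1r.
apply/scalemx_sub; rewrite mulmx_sumr; apply: summx_sub => j _.
by rewrite sub1_rG_exp mulmxA submxMl.
Qed.

Lemma oppmx_sub m n r (A : 'M[F]_(m, n)) (C : 'M[F]_(r, n)) :
  (A <= C)%MS -> (- A <= C)%MS.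
Proof. by move=> AC; rewrite -scaleN1r scalemx_sub. Qed.

Lemma sub1_rGM (a b : qT) (U : 'M[F]_N) :
  (S a <= U)%MS -> (S b <= U)%MS -> (S (a * b)%g <= U)%MS.
Proof.
move=> aU bU; have -> : S (a * b)%g = S b + S a - S a *m S b.
  rewrite rGM [X in _ = _ - X]mulmxBl mul1mx [rG a *m (_ - _)]mulmxBr mulmx1.
  by rewrite opprB [S b + S a]addrC addrACA subrr addr0 addrA subrK.
apply: addmx_sub; first exact: addmx_sub.
by apply: oppmx_sub; apply: mulmx_sub.
Qed.

Lemma sub1_rG1 (U : 'M[F]_N) : (S 1%g <= U)%MS.
Proof. by rewrite rG1 subrr sub0mx. Qed.

Lemma sub1_rGV (a : qT) (U : 'M[F]_N) : (S a <= U)%MS -> (S (a^-1)%g <= U)%MS.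
Proof.
move=> aU; have -> : S (a^-1)%g = - (rG (a^-1)%g *m S a).
  by rewrite mulmxBr mulmx1 -rGM mulVg rG1 opprB.
by apply/oppmx_sub/mulmx_sub.
Qed.

Section Lifts.
Variables (p : nat) (xi : 'I_p -> qT) (k : 'I_p -> nat).
Hypothesis xi_k : forall i, (xi i ^+ k i = 1)%g.
Hypothesis xi_prod : (\prod_(i < p) xi i = 1)%g.
Hypothesis k_unit : forall i, (k i)%:R != 0 :> F.

Local Notation B := (\sum_(i < p) S (xi i))%MS.

Definition lift_sum (r : seq 'I_p) (v : 'I_p -> 'rV[F]_N) : 'rV[F]_N :=
  (\prod_(i <- r) ((v i, xi i) : affine rG))%g.1.

Lemma lift_prod r v : (\prod_(i <- r) ((v i, xi i) : affine rG))%g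
  = (lift_sum r v, (\prod_(i <- r) xi i)%g) :> affine rG.
Proof.
rewrite [LHS]surjective_pairing; congr pair.
by rewrite (big_morph _ affine_snd_morph (erefl _)).
Qed.

Lemma lift_sum_cons i r v :
  lift_sum (i :: r) v = v i *m rG (\prod_(j <- r) xi j)%g + lift_sum r v.
Proof. by rewrite /lift_sum big_cons lift_prod. Qed.

Lemma eq_lift_sum r v w : {in r, v =1 w} -> lift_sum r v = lift_sum r w.
Proof. by move=> vw; rewrite /lift_sum; congr fst;
  apply: eq_big_seq => i /vw ->. Qed.

Lemma lift_sumB r v w :
  lift_sum r (fun i => v i - w i) = lift_sum r v - lift_sum r w.
Proof.
elim: r => [|i r IHr]; first by rewrite /lift_sum !big_nil subrr.
by rewrite !lift_sum_cons IHr mulmxBl opprD addrACA.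
Qed.

Lemma sub1_rG_prod r (U : 'M[F]_N) :
  {in r, forall i, (S (xi i) <= U)%MS} -> (S (\prod_(i <- r) xi i)%g <= U)%MS.
Proof.
elim: r => [|i r IHr] rU; first by rewrite big_nil sub1_rG1.
rewrite big_cons sub1_rGM ?IHr ?rU ?mem_head // => j jr.
by rewrite rU // inE jr orbT.
Qed.

Lemma lift_sum_sub r v :
  (forall i, v i <= S (xi i))%MS -> (lift_sum r v <= B)%MS.
Proof.
move=> vS; elim: r => [|i r IHr]; first by rewrite /lift_sum big_nil sub0mx.
have SB j : (S (xi j) <= B)%MS by apply: (sumsmx_sup j).
rewrite lift_sum_cons addmx_sub // -[rG _](subKr 1%:M) mulmxBr mulmx1.
rewrite addmx_sub ?(submx_trans (vS i)) //.
by apply/oppmx_sub/mulmx_sub/sub1_rG_prod => j _.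
Qed.

(** The tail product [t] moves [v i] only by an element of the span of the tail, because the image
    of [1 - t] lies there. The recursion absorbs this error into its target. *)
Lemma lift_sum_onto r u : uniq r -> (u <= \sum_(i <- r) S (xi i))%MS ->
  exists2 v, (forall i, v i <= S (xi i))%MS & lift_sum r v = u.
Proof.
elim: r u => [|i r IHr] u.
  rewrite big_nil submx0 => _ /eqP ->; exists (fun=> 0) => [i|];
    first exact: sub0mx.
  by rewrite /lift_sum big_nil.
case/andP=> ir r_uniq; rewrite big_cons => /sub_addsmxP[[x y] /= ->].
pose t := (\prod_(j <- r) xi j)%g.
have tS : (S t <= \sum_(j <- r) S (xi j))%MS.
  apply: sub1_rG_prod => j jr; rewrite (big_rem j) //=; exact: addsmxSl.
have [|v vS vr] := IHr (y *m (\sum_(j <- r) S (xi j))%MS + x *m S (xi i) *m S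
  t) r_uniq.
  by rewrite addmx_sub ?submxMl //; apply: mulmx_sub.
exists (fun j => if j == i then x *m S (xi i) else v j) => [j|].
  by case: eqP => [->|_]; rewrite ?submxMl.
rewrite lift_sum_cons eqxx (_ : lift_sum r _ = lift_sum r v); last first.
  by apply: eq_lift_sum => j jr; case: eqP => // ji; rewrite -ji jr in ir.
by rewrite vr -/t [_ *m S t]mulmxBr mulmx1 addrCA [_ *m rG t + _]addrC subrK addrC.
Qed.

(** Translation parts of the tuples over [xi] that satisfy the orbifold relations, in other words
    1-cocycles of the orbifold group with values in the module. *)
Definition lifts : {set {ffun 'I_p -> 'rV[F]_N}} :=
  [set v : {ffun 'I_p -> 'rV[F]_N} |
    [forall i, ((v i, xi i) : affine rG) ^+ k i == 1]%g
    && (\prod_(i < p) ((v i, xi i) : affine rG) == 1)%g].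

(** The torsion relations put each [v i] in the image of [1 - xi i]. On such tuples the product
    relation defines the kernel of an additive map onto the span [B]. *)
Lemma card_lifts :
  (#|lifts| * #|F| ^ \rank B = #|F| ^ \sum_(i < p) \rank (S (xi i)))%N.
Proof.
pose D := [set v : {ffun 'I_p -> 'rV[F]_N} | [forall i, (v i <= S (xi i))%MS]].
have DP (v : {ffun 'I_p -> 'rV[F]_N}) : reflect (forall i, (v i <= S (xi
  i))%MS) (v \in D).
  by rewrite inE; apply: forallP.
pose h (v : {ffun 'I_p -> 'rV[F]_N}) := lift_sum (index_enum 'I_p) v.
have -> : lifts = [set v in D | h v == 0].
  apply/setP=> v; rewrite !inE lift_prod xpair_eqE xi_prod eqxx andbT.
  by congr andb; apply: eq_forallb => i; rewrite affine_exp_eq1.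
have cardD : #|D| = (#|F| ^ \sum_(i < p) \rank (S (xi i)))%N.
  rewrite expn_sum.
  have -> : #|D| = #|family (fun i : 'I_p => [in rowg (S (xi i))])|.
    by apply: eq_card => v; rewrite inE; apply/forallP/familyP=> vS i;
      have := vS i; rewrite ?inE.
  by rewrite card_family foldrE big_map big_enum; apply: eq_bigr => i _;
    rewrite card_rowg.
have imD : h @: D = rowg B.
  apply/setP=> u; rewrite inE; apply/imsetP/idP=> [[v /DP vS ->]|uB].
    exact: lift_sum_sub.
  have [v vS hv] := lift_sum_onto (index_enum_uniq _) uB.
  exists [ffun i => v i]; first by apply/DP=> i; rewrite ffunE.
  by rewrite /h -hv; apply: eq_lift_sum => i _; rewrite ffunE.
rewrite -cardD -card_rowg -imD; apply/esym/card_ffun_additive_fibers.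
  by move=> u v /DP uS /DP vS; apply/DP=> i; rewrite !ffunE addmx_sub ?oppmx_sub.
move=> u v _ _; rewrite /h -lift_sumB; apply: eq_lift_sum => i _.
by rewrite !ffunE.
Qed.

End Lifts.
End AffineGroup.

(** * Permutation modules and orders of elements *)

Section PermutationModule.
Import GRing.Theory.
Local Open Scope ring_scope.
Variables (F : finFieldType) (qT : finGroupType) (T : finType).
Variables (to : {action qT &-> T}) (S : {set T}).
Hypothesis actS : [acts [set: qT], on S | to].

Definition perm_module_mx (a : qT) : 'M[F]_#|S| :=
  \matrix_(i, j) (to (enum_val i) a == enum_val j)%:R.

Lemma act_in a x : (to x a \in S) = (x \in S).
Proof. exact: (acts_act actS (in_setT a)). Qed.

Lemma perm_module_repr : mx_repr [set: qT] perm_module_mx.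
Proof.
split=> [|a b _ _]; apply/matrixP=> i j; rewrite !mxE.
  by rewrite act1 (inj_eq enum_val_inj).
have Sia : to (enum_val i) a \in S by rewrite act_in enum_valP.
rewrite (bigD1 (enum_rank_in (enum_valP i) (to (enum_val i) a))) //= !mxE.
rewrite enum_rankK_in // eqxx mul1r actM big1 ?addr0 // => k ki.
rewrite !mxE; case: eqP => [E|_]; last by rewrite mul0r.
by case/eqP: ki; apply: enum_val_inj; rewrite enum_rankK_in.
Qed.

Definition perm_module := MxRepresentation perm_module_repr.

Lemma perm_module_fixed (v : 'rV[F]_#|S|) a :
  (v *m perm_module a == v) =
  [forall i, forall j, (to (enum_val i) a == enum_val j) ==> (v 0 j == v 0 i)].
Proof.
have vPE i j : to (enum_val i) a = enum_val j -> (v *m perm_module a) 0 j = v 0 i.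
  move=> ij; rewrite mxE (bigD1 i) //= !mxE ij eqxx mulr1 big1 ?addr0 // => k ki.
  rewrite !mxE; case: eqP => [E|]; last by rewrite mulr0.
  by case/eqP: ki; apply: enum_val_inj; apply: (act_inj to a); rewrite E ij.
apply/eqP/forallP=> [vP i|vP].
  by apply/forallP=> j; apply/implyP=> /eqP/vPE <-; rewrite vP.
apply/rowP=> j.
have Sj : to (enum_val j) a^-1%g \in S by rewrite act_in enum_valP.
pose i := enum_rank_in (enum_valP j) (to (enum_val j) a^-1%g).
have ij : to (enum_val i) a = enum_val j by rewrite enum_rankK_in // actKV.
by rewrite (vPE i) //; have /forallP/(_ j)/implyP/(_ (introT eqP ij))/eqP := vP i.
Qed.

(** The kernel of [1 - a] consists of the functions constant on the orbits of [<[a]>]. Comparing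
    cardinals over the finite field gives its dimension without choosing a basis. *)
Lemma perm_module_rank a :
  (\rank (1%:M - perm_module a)%R + #|orbit to <[a]> @: S| = #|S|)%N.
Proof.
pose O := orbit to <[a]> @: S.
pose G (h : {ffun {set T} -> F}) : 'rV[F]_#|S| :=
  \row_i h (orbit to <[a]> (enum_val i)).
pose D := [set h : {ffun {set T} -> F} | h \in pffun_on 0 [in O] predT].
have DP h : h \in D -> forall B, B \notin O -> h B = 0.
  by rewrite inE => /pffun_onP[/supportP hO _] B BO; apply: hO.
have G_inj : {in D &, injective G}.
  move=> h h' /DP h0 /DP h0' GG; apply/ffunP=> B.
  have [/imsetP[x Sx ->]|BO] := boolP (B \in O); last by rewrite h0 ?h0'.
  have := congr1 (fun v : 'rV_#|S| => v 0 (enum_rank_in Sx x)) GG.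
  by rewrite !mxE enum_rankK_in.
have cardD : #|D| = (#|F| ^ #|O|)%N.
  by rewrite cardsE card_pffun_on.
have imG : G @: D = rowg (kermx (1%:M - perm_module a)).
  apply/setP=> v; rewrite inE.
  have -> : (v <= kermx (1%:M - perm_module a))%MS = (v *m perm_module a == v).
    by rewrite (sameP sub_kermxP eqP) mulmxBr mulmx1 subr_eq0 eq_sym.
  rewrite perm_module_fixed; apply/imsetP/forallP=> [[h _ ->] i|vP].
    apply/forallP=> j; apply/implyP=> /eqP ij; rewrite !mxE -ij; apply/eqP.
    congr (h _); apply/orbit_eqP.
    by rewrite mem_orbit ?cycle_id.
  have vS (i : 'I_#|S|) j : enum_val j \in orbit to <[a]> (enum_val i) -> v 0 j
    = v 0 i.
    case/orbitP=> _ /cycleP[n ->].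
    elim: n i => [|n IHn] i; first by rewrite expg0 act1 => /enum_val_inj ->.
    have Sia : to (enum_val i) a \in S by rewrite act_in enum_valP.
    rewrite expgS actM => /esym jE.
    pose i' := enum_rank_in (enum_valP i) (to (enum_val i) a).
    have ii' : to (enum_val i) a = enum_val i' by rewrite enum_rankK_in.
    rewrite (IHn i') -?ii' ?jE //.
    by have /forallP/(_ i')/implyP/(_ (introT eqP ii'))/eqP := vP i.
  pose h : {ffun {set T} -> F} := [ffun B =>
    if [pick i : 'I_#|S| | orbit to <[a]> (enum_val i) == B] is Some i then v 0
      i else 0].
  exists h.
    rewrite inE; apply/pffun_onP; split=> //; apply/supportP=> B BO.
    rewrite ffunE; case: pickP => // i /eqP iB.
    by case/negP: BO; rewrite -iB; apply: imset_f; apply: enum_valP.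
  apply/rowP=> i; rewrite mxE ffunE; case: pickP => [j /eqP ji|/(_ i)];
    last by rewrite eqxx.
  by apply: vS; rewrite ji orbit_refl.
have F_gt1 : (1 < #|F|)%N := finRing_gt1 F.
have : (\rank (kermx (1%:M - perm_module a)) = #|O|)%N.
  apply/eqP; rewrite -(eqn_exp2l _ _ F_gt1) -card_rowg -imG card_in_imset //.
  by rewrite cardD.
by rewrite mxrank_ker => <-; rewrite subnKC // rank_leq_row.
Qed.

End PermutationModule.

Section CyclicOrders.
Import GRing.Theory Num.Theory Order.TTheory.
Variable qT : finGroupType.
Implicit Types (a b c x y : qT) (C : {group qT}).
Local Open Scope group_scope.

Definition norbits C a : nat := #|orbit 'Rs <[a]> @: rcosets C [set: qT]|.

Lemma acts_rcosets C (A : {set qT}) : [acts A, on rcosets C [set: qT] | 'Rs].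
Proof.
apply/subsetP=> a _; rewrite !inE; apply/subsetP=> _ /rcosetsP[x _ ->].
rewrite inE /= rcosetE -rcosetM; apply/rcosetsP.
by exists (x * a); rewrite ?inE.
Qed.

(** The coset [C :* x] is fixed by [b] exactly when [x * b * x^-1] is in [C]; inverting [x] turns
    this into a condition on [b ^ x]. *)
Lemma card_fix_rcosets C b :
  (#|C| * #|'Fix_(rcosets C [set: qT] | 'Rs)[b]| = #|[set x | (b ^ x)%g \in C]|)%N.
Proof.
have inv_inj : injective (@monoid.inv qT) by apply: invg_inj.
rewrite -(card_imset _ inv_inj) -[RHS]sum1_card.
set E := 'Fix_(_ | _)[b].
have EP B : reflect (exists x, [/\ B = C :* x & x * b * x^-1 \in C]) (B \in E).
  rewrite !inE sub1set inE /= rcosetE;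
    apply: (iffP andP) => [[/rcosetsP[x _ ->] /eqP xb]|[x [-> xb]]].
    exists x; split=> //; have := rcoset_refl C (x * b).
    by rewrite rcosetM xb mem_rcoset.
  split; first by apply/rcosetsP; exists x; rewrite ?inE.
  by rewrite -rcosetM; apply/eqP/rcoset_eqP; rewrite mem_rcoset.
rewrite [RHS](partition_big (fun x => C :* x) (mem E)) /=; last first.
  move=> _ /imsetP[x + ->]; rewrite inE => xC; apply/EP; exists x^-1.
  by rewrite invgK -mulgA.
rewrite mulnC -sum_nat_const; apply: eq_bigr => B /EP[x [-> xC]].
rewrite -(card_rcoset C x) -sum1_card; apply: eq_bigl => y.
apply/idP/andP=> [|[_ /eqP <-]]; last exact: rcoset_refl.
case/rcosetP=> c Cc ->; split; last by rewrite rcosetM (rcoset_id Cc) eqxx.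
apply/imsetP; exists (c * x)^-1; last by rewrite invgK.
by rewrite inE conjgE invgK invgM !mulgA groupMr ?groupV // -!mulgA groupMl //
  mulgA.
Qed.

Local Open Scope ring_scope.

(** By Burnside's lemma, its sum over any subgroup [C] is [#|C|] times the number of orbits of [a]
    on the cosets of [C]. The point is that the function itself does not depend on [C]. *)
Definition conj_weight a c : rat :=
  \sum_(b in <[a]>%g) #|[set x | (b ^ x)%g == c]|%:R / #[a]%g%:R.

Lemma norbits_conj_weight C a :
  (norbits C a)%:R * #|C|%:R = \sum_(c in C) conj_weight a c.
Proof.
have o0 : #[a]%g%:R != 0 :> rat by rewrite pnatr_eq0 -lt0n order_gt0.
rewrite exchange_big /=; apply: (mulIf o0); rewrite mulr_suml.
have -> : (norbits C a)%:R * #|C|%:R * #[a]%g%:R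
    = ((norbits C a * #|<[a]>%g|) * #|C|)%N%:R :> rat.
  by rewrite !natrM mulrAC.
rewrite -(Frobenius_Cauchy (acts_rcosets C _)) big_distrl natr_sum.
apply: eq_bigr => b _; rewrite /= mulnC card_fix_rcosets mulr_suml.
rewrite -sum1_card (partition_big (fun x => (b ^ x)%g) (mem C)) /=; last first.
  by move=> x; rewrite inE.
rewrite natr_sum; apply: eq_bigr => c Cc; rewrite divfK // -sum1_card.
congr (_%:R); apply: eq_bigl => x; rewrite !inE.
by case: eqP => [->|]; rewrite ?andbF ?andbT.
Qed.

Lemma card_order_cycle a m :
  #|[set b in <[a]>%g | #[b]%g == m]| = if (m %| #[a]%g)%N then totient m else 0%N.
Proof.
case: ifPn => [ma|ma]; last first.
  apply/eqP; rewrite cards_eq0; apply/eqP/setP=> b; rewrite !inE.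
  by apply/negP=> /andP[ba /eqP bm]; case/negP: ma; rewrite -bm order_dvdG.
pose d := (a ^+ (#[a]%g %/ m))%g.
have m_gt0 : (0 < m)%N by apply: dvdn_gt0 ma; apply: order_gt0.
have dm : #[d]%g = m.
  have ad : (#[a]%g %/ m %| #[a]%g)%N by apply: dvdn_div.
  by rewrite orderXdiv // -{1}(divnK ma) mulKn // divn_gt0 // dvdn_leq ?order_gt0.
rewrite -dm totient_gen; apply: eq_card => b; rewrite !inE /generator.
apply/andP/eqP=> [[ba /eqP bm]|db].
  have := cycle_sub_group ma => /setP/(_ <[b]>%G).
  rewrite !inE cycle_subG ba /= -[#|_|]/(#[b]%g) bm dm eqxx =>
    /esym/eqP/(congr1 val) /=.
  by move=> ->.
have bd : b \in <[d]>%g by rewrite db cycle_id.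
split; last by rewrite /order -db.
by apply: subsetP bd; rewrite cycle_subG groupX ?cycle_id.
Qed.

(** Every [x] conjugates an element [b] of order [m] to exactly one [c] of order [m], so each such
    [b] in [<[a]>] contributes [#|qT| / #[a]]. *)
Lemma sum_conj_weight a m :
  \sum_(c | #[c]%g == m) conj_weight a c
  = if (m %| #[a]%g)%N then #|qT|%:R * (totient m)%:R / #[a]%g%:R else 0.
Proof.
rewrite exchange_big /=.
have -> : \sum_(b in <[a]>%g) \sum_(c | #[c]%g == m)
      #|[set x | (b ^ x)%g == c]|%:R / #[a]%g%:R
    = \sum_(b in <[a]>%g | #[b]%g == m) (#|qT|%:R / #[a]%g%:R) :> rat.
  rewrite big_mkcondr /=; apply: eq_bigr => b _; rewrite -mulr_suml -natr_sum.
  case: eqP => [bm|bm]; last first.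
    rewrite big1 ?mul0r // => c /eqP cm; apply/eqP; rewrite cards_eq0.
    apply/eqP/setP=> x; rewrite !inE; apply/negP=> /eqP xc.
    by case: bm; rewrite -cm -xc orderJ.
  congr (_%:R / _); rewrite -sum1_card [RHS](partition_big (fun x => (b ^ x)%g)
    (fun c => #[c]%g == m)) /=.
    by apply: eq_bigr => c _; rewrite sum1_card; apply: eq_card => x; rewrite !inE.
  by move=> x _; rewrite orderJ bm.
rewrite sumr_const -[X in _ *+ X](cardsE) card_order_cycle.
by case: ifP => _; [rewrite -[LHS]mulr_natr mulrAC|rewrite mulr0n].
Qed.

End CyclicOrders.

(** * Recovering the orders from the orbit counts *)

Section OrderCounting.
Import GRing.Theory Num.Theory Order.TTheory.
Local Open Scope ring_scope.

Lemma sum_inv_multiples (I : finType) (e : I -> nat) B m :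
  (forall i, 0 < e i < B)%N ->
  \sum_(i | (m %| e i)%N) (e i)%:R^-1 =
  \sum_(v < B | (m %| v)%N) #|[set i | e i == v]|%:R / v%:R :> rat.
Proof.
move=> eB; have eltB i : (e i < B)%N by case/andP: (eB i).
rewrite (partition_big (fun i => Ordinal (eltB i)) (fun v : 'I_B => m %| v)%N) //=.
apply: eq_bigr => v mv.
have -> : \sum_(i | (m %| e i)%N && (Ordinal (eltB i) == v)) (e i)%:R^-1
        = \sum_(i in [set i | e i == v]) v%:R^-1 :> rat.
  apply: eq_big => [i|i /andP[_ /eqP <-] //].
  by rewrite inE -val_eqE /=; case: eqP => [->|]; rewrite ?mv ?andbF.
by rewrite sumr_const -[LHS]mulr_natl.
Qed.

(** Descending induction on [m], starting above all entries: the proper multiples of [m] have known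
    counts, so the sum determines the count of [m] itself. *)
Lemma sum_inv_multiples_inj (I I' : finType) (e : I -> nat) (e' : I' -> nat) :
  (forall i, 0 < e i)%N -> (forall j, 0 < e' j)%N ->
  (forall m, (1 < m)%N -> \sum_(i | (m %| e i)%N) (e i)%:R^-1
    = \sum_(j | (m %| e' j)%N) (e' j)%:R^-1 :> rat) ->
  forall m, (1 < m)%N -> #|[set i | e i == m]| = #|[set j | e' j == m]|.
Proof.
move=> e_gt0 e_gt0' E.
pose B := (\sum_i e i + \sum_j e' j).+1%N.
have eB i : (0 < e i < B)%N.
  by rewrite e_gt0 ltnS (bigD1 i) //= -addnA leq_addr.
have eB' j : (0 < e' j < B)%N.
  by rewrite e_gt0' ltnS addnC (bigD1 j) //= -addnA leq_addr.
suff H n m : (1 < m)%N -> (B <= m + n)%N ->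
    #|[set i | e i == m]| = #|[set j | e' j == m]|.
  by move=> m m1; apply: (H B) => //; apply: leq_addl.
elim: n m => [|n IHn] m m1 Bm.
  rewrite addn0 in Bm.
  have big0 (I0 : finType) (d : I0 -> nat) : (forall i, 0 < d i < B)%N ->
    #|[set i | d i == m]| = 0%N.
    move=> dB; apply/eqP; rewrite cards_eq0; apply/eqP/setP=> i; rewrite !inE.
    by apply/negP=> /eqP dm; have := dB i; rewrite dm andbC ltnNge Bm.
  by rewrite !big0.
have [Bm'|mB] := leqP B m; first by apply: IHn => //;
  apply: leq_trans Bm' (leq_addr _ _).
have := E m m1; rewrite (sum_inv_multiples _ eB) (sum_inv_multiples _ eB').
rewrite (bigD1 (Ordinal mB)) //= [RHS](bigD1 (Ordinal mB)) //=.
rewrite (eq_bigr (fun v : 'I_B => #|[set j | e' j == v]|%:R / v%:R)); last first.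
  (* The index 0 is a multiple of [m] too, but contributes 0, as the inverse of 0 is 0. *)
  move=> v /andP[mv vm]; have [v0|v_gt0] := posnP v.
    by rewrite v0 invr0 !mulr0.
  have mv' : (m < v)%N by rewrite ltn_neqAle dvdn_leq // andbT eq_sym -[m]/(val
    (Ordinal mB)) val_eqE.
  rewrite IHn //; first exact: ltn_trans mv'.
  by apply: leq_trans Bm _; rewrite addnS -addSn leq_add2r.
move/addIr; have m0 : m%:R^-1 != 0 :> rat by rewrite invr_eq0 pnatr_eq0 -lt0n ltnW.
by move/(mulIf m0)/eqP; rewrite eqr_nat => /eqP.
Qed.

Variable qT : finGroupType.

(* Sorting the elements by the cyclic subgroup which they generate. *)
Lemma cyclic_sum_constant (D : qT -> rat) (E : rat) :
  (forall y, \sum_(c in <[y]>%g) D c = E) ->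
  forall m, (1 < m)%N -> \sum_(c | #[c]%g == m) D c = 0.
Proof.
move=> DE m m1.
pose g (Z : {set qT}) := \sum_(c | <[c]>%g == Z) D c.
have D1 : D 1%g = E.
  by rewrite -(DE 1%g) cycle1 big_set1.
(* Induction on the order of [y]: in the sum over [<[y]>] the term at 1 is already [E], and the
   smaller nontrivial cyclic subgroups contribute 0, so the generators of [<[y]>] contribute 0 as
   well. *)
have g0 n y : (#[y]%g <= n)%N -> y != 1%g -> g <[y]>%g = 0.
  elim: n y => [|n IHn] y; first by rewrite leqn0 -leqn0 leqNgt order_gt0.
  move=> yn y1; have := DE y; rewrite (bigD1 1%g) ?group1 //= D1.
  move/eqP; rewrite -[X in _ == X]addr0 (inj_eq (addrI _)) => /eqP.
  rewrite (partition_big (fun c => <[c]>%g) (fun Z => Z \in [set <[c]>%g | c in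
    <[y]>%g & c != 1%g])) /=; last first.
    by move=> c cy; apply: imset_f; rewrite inE.
  rewrite (bigD1 <[y]>%g) /=; last by apply: imset_f; rewrite inE cycle_id.
  rewrite [X in _ + X]big1 ?addr0.
    move=> s0; rewrite /g -[RHS]s0; apply: eq_bigl => c;
      apply/idP/idP=> [/eqP cy|/andP[_ ->] //].
    by rewrite cy eqxx andbT -cycle_subG cy subxx /= -cycle_eq1 cy cycle_eq1.
  move=> _ /andP[/imsetP[z + ->] zy]; rewrite inE => /andP[zinY z1].
  have zproper : (#[z]%g < #[y]%g)%N.
    by rewrite /order proper_card // properEneq zy cycle_subG.
  rewrite -[RHS](IHn z) //; last by rewrite -ltnS (leq_trans zproper).
  apply: eq_bigl => c; apply/andP/idP=> [[] //|/eqP cz]; split; last exact/eqP.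
  rewrite -cycle_subG cz cycle_subG zinY /=.
  by rewrite -cycle_eq1 cz cycle_eq1.
rewrite (partition_big (fun c => <[c]>%g) (fun Z => Z \in [set <[c]>%g | c in
  [set: qT] & #[c]%g == m])) /=; last first.
  by move=> c cm; apply: imset_f; rewrite !inE.
apply: big1 => _ /imsetP[z + ->]; rewrite !inE => /eqP zm.
rewrite -[RHS](g0 _ z (leqnn _)); last by rewrite -order_gt1 zm.
apply: eq_bigl => c; apply/andP/idP=> [[] //|/eqP cz]; split; last exact/eqP.
by rewrite /order cz -zm.
Qed.

(** The difference [D] of the total weights has the same sum [(p - q) * #|qT|] over every subgroup.
    As [p] and [q] may still differ, this constant is only eliminated by restricting to elements of
    order [m > 1]. *)
Lemma orbit_counts_orders p q (xi : 'I_p -> qT) (xi' : 'I_q -> qT) :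
  (forall C : {group qT},
     (\sum_(i < p) (#|rcosets C [set: qT]| - norbits C (xi i))
      = \sum_(j < q) (#|rcosets C [set: qT]| - norbits C (xi' j)))%N) ->
  forall m, (1 < m)%N ->
    #|[set i | #[xi i]%g == m]| = #|[set j | #[xi' j]%g == m]|.
Proof.
move=> orbE; apply: sum_inv_multiples_inj; try by move=> *; apply: order_gt0.
pose D c : rat := \sum_(i < p) conj_weight (xi i) c - \sum_(j < q) conj_weight
  (xi' j) c.
have DE (C : {group qT}) : \sum_(c in C) D c = (p%:R - q%:R) * #|qT|%:R.
  have orb_le a : (norbits C a <= #|rcosets C [set: qT]|)%N by apply:
    leq_imset_card.
  have side r (ze : 'I_r -> qT) :
      (\sum_(i < r) (#|rcosets C [set: qT]| - norbits C (ze i)))%N%:R * #|C|%:R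
      = r%:R * #|qT|%:R - \sum_(c in C) \sum_(i < r) conj_weight (ze i) c.
    rewrite exchange_big /= natr_sum mulr_suml.
    have -> : r%:R * #|qT|%:R = \sum_(i < r) #|qT|%:R :> rat.
      by rewrite sumr_const card_ord mulr_natl.
    rewrite -sumrB; apply: eq_bigr => i _;
      rewrite natrB // mulrBl norbits_conj_weight.
    by rewrite -natrM mulnC Lagrange ?subsetT // cardsT.
  rewrite sumrB mulrBl.
  have := congr1 (fun n => n%:R * #|C|%:R : rat) (orbE C); rewrite !side.
  set A := \sum_(c in C) _; set A' := \sum_(c in C) _ => AA.
  have -> : A = p%:R * #|qT|%:R - (q%:R * #|qT|%:R - A').
    by rewrite -AA opprB addrCA subrr addr0.
  by rewrite opprB [A' - _]addrC addrA addrK.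
move=> m m1; have := cyclic_sum_constant (fun y => DE <[y]>%G) m1.
rewrite sumrB exchange_big [X in _ - X]exchange_big /= => /eqP;
  rewrite subr_eq0 => /eqP.
under eq_bigr => i _ do rewrite sum_conj_weight.
under [RHS]eq_bigr => i _ do rewrite sum_conj_weight.
rewrite -!big_mkcond -!mulr_sumr.
suff u0 : #|qT|%:R * (totient m)%:R != 0 :> rat by move/(mulfI u0).
rewrite mulf_neq0 // pnatr_eq0 -lt0n; last by rewrite totient_gt0 ltnW.
by apply/card_gt0P; exists 1%g.
Qed.

End OrderCounting.

From mathcomp Require Import boolp classical_sets functions.

(** * The groups J(K) and their normal subgroups *)

Section MorphismLemmas.
Local Open Scope group_scope.
Variables (G H : groupType) (f : G -> H).
Hypothesis fM : {morph f : x y / x * y}.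

Lemma morph_one : f 1 = 1.
Proof. by apply: (mulgI (f 1)); rewrite -fM !mulg1. Qed.

Lemma morph_inv x : f x^-1 = (f x)^-1.
Proof. by apply: (mulgI (f x)); rewrite -fM !mulgV morph_one. Qed.

Lemma morph_exp x n : f (x ^+ n) = f x ^+ n.
Proof. by elim: n => [|n IHn]; rewrite ?morph_one // !expgS fM IHn. Qed.

Lemma morph_conj x y : f (x ^ y) = f x ^ f y.
Proof. by rewrite !conjgE !fM morph_inv. Qed.

Lemma morph_bigprod I (r : seq I) F :
  f (\prod_(i <- r) F i) = \prod_(i <- r) f (F i).
Proof. exact: (big_morph f fM morph_one). Qed.

End MorphismLemmas.

Section JTheory.
Local Open Scope group_scope.
Variable p : nat.
Implicit Type K : p.-tuple natoo.

(** Total in [h], by evaluating a representative word; it is the induced homomorphism as soon as [h]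
    satisfies the relations, and terms need not carry a proof of this. *)
Definition J_lift K (H : groupType) (h : 'I_p -> H) (x : J K) : H :=
  eval_word h (generic_quotient.repr x).

Lemma eval_cyc_word (H : groupType) (h : 'I_p -> H) :
  eval_word h (cyc_word p) = \prod_(i < p) h i.
Proof. by rewrite /eval_word /cyc_word big_map enumT [index_enum _]unlock. Qed.

Lemma eval_word_cat (H : groupType) (h : 'I_p -> H) u v :
  eval_word h (u ++ v) = eval_word h u * eval_word h v.
Proof. by rewrite /eval_word big_cat. Qed.

Lemma eval_word_nseq (H : groupType) (h : 'I_p -> H) k i :
  eval_word h (nseq k (i, false)) = h i ^+ k.
Proof.
elim: k => [|k IHk]; first by rewrite /eval_word big_nil.
by rewrite expgS -IHk /eval_word /= big_cons.
Qed.

Section Lift.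
Variables (K : p.-tuple natoo) (H : groupType) (h : 'I_p -> H).
Hypothesis hz : forall i, commute (\prod_(j < p) h j) (h i).
Hypothesis hk : forall i k, tnth K i = Some k -> h i ^+ k = 1.

(** The rotation [d * t] of a product [t * d] is its conjugate by [t], so the rotations agree when
    the product commutes with every factor. *)
Lemma eval_J_rel u v : J_rel K u v -> eval_word h u = eval_word h v.
Proof.
case=> [i _|i k Kik]; last by rewrite eval_word_nseq hk // /eval_word big_nil.
rewrite /rot eval_word_cat -[in LHS](cat_take_drop i (cyc_word p)) eval_word_cat.
set t := eval_word h (take _ _); set d := eval_word h (drop _ _).
have tdz : t * d = \prod_(j < p) h j.
  by rewrite -eval_word_cat cat_take_drop eval_cyc_word.
have: commute (\prod_(j < p) h j) t.
  rewrite /t /eval_word; apply: commute_prod => -[j b] _ /=.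
  by case: b; [apply: commuteV|]; apply: hz.
by rewrite -tdz /commute -mulgA => /mulgI.
Qed.

Lemma J_liftM : {morph J_lift (K := K) h : x y / x * y}.
Proof.
have [f [[fM fg] _]] := presentedP eval_J_rel.
have ecw u : eval_word h (generic_quotient.repr (class_of_word (J_rel K) u)) =
  eval_word h u.
  exact/(eval_word_pres_eq eval_J_rel)/repr_class_of_word.
move=> x y; rewrite /J_lift -{1}(class_of_wordK x) -{1}(class_of_wordK y).
by rewrite -class_of_wordM ecw eval_word_cat.
Qed.

Lemma J_lift_gen i : J_lift h (J_gen K i) = h i.
Proof.
rewrite /J_lift /J_gen /pres_gen.
rewrite (eval_word_pres_eq eval_J_rel (repr_class_of_word _ _)).
by rewrite /eval_word big_seq1.
Qed.

End Lift.

Lemma J_ind K (P : J K -> Prop) :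
  P 1 -> (forall x y, P x -> P y -> P (x * y)) -> (forall x, P x -> P x^-1) ->
  (forall i, P (J_gen K i)) -> forall x, P x.
Proof.
move=> P1 PM PV Pg x; rewrite -(class_of_wordK x).
elim: (generic_quotient.repr x) => [|[i b] w IHw]; first exact: P1.
rewrite -cat1s class_of_wordM; apply: PM => //; case: b; last exact: Pg.
suff -> : class_of_word (J_rel K) [:: (i, true)] = (J_gen K i)^-1 by apply: PV.
apply: (mulgI (J_gen K i)); rewrite mulgV /J_gen /pres_gen -class_of_wordM.
by apply/class_of_wordP; apply: (pres_cancel _ (i, false)).
Qed.

Lemma J_morph_eq K (H : groupType) (f g : J K -> H) :
  {morph f : x y / x * y} -> {morph g : x y / x * y} ->
  (forall i, f (J_gen K i) = g (J_gen K i)) -> f =1 g.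
Proof.
move=> fM gM fg; apply: J_ind => //; first by rewrite !morph_one.
- by move=> x y fgx fgy; rewrite fM gM fgx fgy.
- by move=> x fgx; rewrite !morph_inv // fgx.
Qed.

Lemma J_gen_exp K i k : tnth K i = Some k -> J_gen K i ^+ k = 1.
Proof.
move=> Kik; have -> : J_gen K i ^+ k = class_of_word (J_rel K) (nseq k (i, false)).
  elim: k {Kik} => // k IHk; rewrite expgS IHk.
  by rewrite /J_gen /pres_gen -class_of_wordM.
by apply/class_of_wordP/pres_relation; constructor.
Qed.

Definition J_center K : J K := \prod_(i < p) J_gen K i.

Lemma J_center_enum K : J_center K = \prod_(i <- enum 'I_p) J_gen K i.
Proof. by rewrite enumT /J_center [index_enum _]unlock. Qed.

Lemma class_cyc_word K : class_of_word (J_rel K) (cyc_word p) = J_center K.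
Proof.
rewrite J_center_enum /cyc_word /=.
elim: (enum 'I_p) => [|i s IHs]; first by rewrite big_nil.
by rewrite big_cons -IHs /J_gen /pres_gen -class_of_wordM.
Qed.

Lemma J_centerC K x : commute (J_center K) x.
Proof.
elim/J_ind: x => [|x y|x|i]; first exact: commute1.
- exact: commuteM.
- exact: commuteV.
have ip : (i < size (cyc_word p))%N by rewrite size_map size_enum_ord.
pose u := class_of_word (J_rel K) (drop i.+1 (cyc_word p) ++ take i (cyc_word p)).
have rot1 : J_center K = J_gen K i * u.
  rewrite -class_cyc_word /u /J_gen /pres_gen -class_of_wordM.
  apply/class_of_wordP/pres_relation.
  have -> : [:: (i, false)] ++ drop i.+1 (cyc_word p) ++ take i (cyc_word p)
            = rot i (cyc_word p).
    rewrite /rot [in RHS](drop_nth (i, false)) //.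
    by rewrite (nth_map i) ?nth_ord_enum // size_enum_ord.
  by constructor.
have rot2 : J_center K = u * J_gen K i.
  rewrite -class_cyc_word /u /J_gen /pres_gen -class_of_wordM -catA.
  have -> : take i (cyc_word p) ++ [:: (i, false)] = take i.+1 (cyc_word p).
    rewrite (take_nth (i, false)) // -cats1.
    by rewrite (nth_map i) ?nth_ord_enum // size_enum_ord.
  have [lt_ip|le_pi] := ltnP i.+1 p.
    by apply/class_of_wordP/pres_relation; apply: (J_rotation K lt_ip).
  by rewrite drop_oversize ?take_oversize // size_map size_enum_ord.
by rewrite /commute {1}rot1 -mulgA -rot2.
Qed.

End JTheory.

(** * Generalized J-groups modulo central elements *)

Section GeneralizedJ.
Local Open Scope group_scope.
Variables (p : nat) (K : p.-tuple natoo) (K' : p.-tuple nat).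
Local Notation W := (generalized_J K K').
Local Notation s := (J_gen K).

Lemma generalized_J_normal : normal_subgroup W.
Proof.
split; first by move=> N [[]].
- move=> x y Wx Wy N nN; have [[_ NM NV NJ] _] := nN.
  by apply: NM; [apply: Wx|apply: Wy].
- by move=> x Wx N nN; have [[_ NM NV NJ] _] := nN; apply: NV; apply: Wx.
- by move=> x g Wx N nN; have [[_ NM NV NJ] _] := nN; apply: NJ; apply: Wx.
Qed.

Lemma generalized_J1 : W 1.
Proof. by have [] := generalized_J_normal. Qed.

Lemma generalized_JM x y : W x -> W y -> W (x * y).
Proof. by case: generalized_J_normal => _ WM _ _; apply: WM. Qed.

Lemma generalized_JV x : W x -> W x^-1.
Proof. by case: generalized_J_normal => _ _ WV _; apply: WV. Qed.

Lemma generalized_JJ x g : W x -> W (x ^ g).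
Proof. by case: generalized_J_normal => _ _ _ WJ; apply: WJ. Qed.

Lemma generalized_JX x n : W x -> W (x ^+ n).
Proof.
move=> Wx; elim: n => [|n IHn]; first exact: generalized_J1.
by rewrite expgS; apply: generalized_JM.
Qed.

Lemma generalized_J_gen i : W (s i ^+ tnth K' i).
Proof. by move=> N [_ sub]; apply: sub; exists i. Qed.

Lemma generalized_J_gen_dvd i n : (tnth K' i %| n)%N -> W (s i ^+ n).
Proof.
case/dvdnP=> m ->; rewrite mulnC expgnA.
by apply: generalized_JX; apply: generalized_J_gen.
Qed.

Lemma generalized_J_min (N : set (J K)) :
  normal_subgroup N -> (forall i, N (s i ^+ tnth K' i)) -> forall x, W x -> N x.
Proof. by move=> nN Ng x; apply; split => // _ [i _ <-]. Qed.

Lemma reflectionsP x : reflections K K' x -> W x.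
Proof.
case=> i [t [g [[n tn] _ ->]]]; apply: generalized_JJ.
have Wt : W (s i ^+ tnth K' i ^+ n).
  by apply: generalized_JX; apply: generalized_J_gen.
by case: tn => ->; [|apply: generalized_JV].
Qed.

(* Stands for membership in the cyclic subgroup generated by [J_center K]. *)
Definition in_center (c : J K) : Prop :=
  (forall g, commute c g) /\
  forall (H : groupType) (f : J K -> H),
    {morph f : x y / x * y} -> f (J_center K) = 1 -> f c = 1.

Lemma in_centerM c d : in_center c -> in_center d -> in_center (c * d).
Proof.
move=> [cC cz] [dC dz]; split=> [g|H f fM fz].
  by apply/commute_sym/commuteM; apply: commute_sym.
by rewrite fM (cz _ _ fM) // (dz _ _ fM) // mulg1.
Qed.

Lemma in_centerV c : in_center c -> in_center c^-1.
Proof.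
move=> [cC cz]; split=> [g|H f fM fz].
  by apply/commute_sym/commuteV; apply: commute_sym.
by rewrite (morph_inv fM) (cz _ _ fM) // invg1.
Qed.

Lemma in_center1 : in_center 1.
Proof. by split=> [g|H f fM _]; [apply/commute_sym/commute1|rewrite morph_one]. Qed.

Lemma in_centerX n : in_center (J_center K ^+ n).
Proof.
split=> [g|H f fM fz]; first by apply/commute_sym/commuteX/commute_sym/J_centerC.
by rewrite (morph_exp fM) fz expg1n.
Qed.

(** Congruence modulo [W], in place of the quotient group. *)
Let E x y := W (x^-1 * y).

Let Erefl x : E x x.
Proof. by rewrite /E mulVg; apply: generalized_J1. Qed.

Let Esym x y : E x y -> E y x.
Proof. by move=> /generalized_JV; rewrite /E invgM invgK. Qed.

Let Etrans x y u : E x y -> E y u -> E x u.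
Proof.
by move=> Exy Eyu; have := generalized_JM Exy Eyu; rewrite mulgA mulgK.
Qed.

Let EM x y u v : E x y -> E u v -> E (x * u) (y * v).
Proof.
move=> Exy Euv; have := generalized_JM (generalized_JJ u Exy) Euv.
by rewrite /E conjgE !mulgA mulgK invgM.
Qed.

Let EX x y n : E x y -> E (x ^+ n) (y ^+ n).
Proof. by move=> Exy; elim: n => // n IHn; rewrite !expgS; apply: EM. Qed.

Let E1 x : W x -> E 1 x.
Proof. by rewrite /E invg1 mul1g. Qed.

Let Egen1 i n : (1 < tnth K' i)%N -> n = 1 %[mod tnth K' i] -> E (s i) (s i ^+ n).
Proof.
move=> k1; rewrite (modn_small k1) => n1.
rewrite (divn_eq n (tnth K' i)) n1 addn1 expgS /E mulKg.
by apply: generalized_J_gen_dvd; apply: dvdn_mull.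
Qed.

(** Modulo [W] only the at most two generators with [k'_i != 1] survive, and their product is [z].
    They commute and their orders divide coprime numbers, so by the Chinese remainder theorem each
    of them is a power of [z]. *)
Lemma generalized_J_decomp g : reduced K K' ->
  exists w c, [/\ W w, in_center c & g = w * c].
Proof.
move=> [[_ def] two cop].
elim/J_ind: g => [|x y|x|i].
- by exists 1, 1; rewrite mulg1; split => //;
  [apply: generalized_J1|apply: in_center1].
- move=> [w [c [Ww Zc ->]]] [w' [c' [Ww' Zc' ->]]].
  exists (w * w'), (c * c'); split; [exact: generalized_JM|exact: in_centerM|].
  by rewrite !mulgA -(mulgA w c) (Zc.1 w') !mulgA.
- move=> [w [c [Ww Zc ->]]]; exists w^-1, c^-1.
  split; [exact: generalized_JV|exact: in_centerV|].
  by rewrite -invgM (Zc.1 w).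
suff [n En] : exists n, E (J_center K ^+ n) (s i).
  exists (s i * J_center K ^- n), (J_center K ^+ n).
  split; [|exact: in_centerX|by rewrite mulgVK].
  have [zC _] := in_centerX n.
  suff -> : s i * J_center K ^- n = J_center K ^- n * s i by [].
  by apply: commuteV; apply: commute_sym.
have [ki1|ki1] := eqVneq (tnth K' i) 1%N.
  by exists 0%N; apply: E1; have := generalized_J_gen i; rewrite ki1.
pose P j := tnth K' j != 1%N.
have gt1 j : P j -> (1 < tnth K' j)%N.
  by rewrite /P; have [_ + _] := def j; case: (tnth K' j) => [|[]].
have zE (r : seq 'I_p) : E (\prod_(j <- r) s j) (\prod_(j <- r | P j) s j).
  elim: r => [|j r IHr]; first by rewrite !big_nil.
  rewrite !big_cons; case: ifPn => [_|]; first exact: EM.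
  rewrite negbK => /eqP kj1; rewrite -[X in E _ X]mul1g; apply: EM => //.
  by apply: Esym; apply: E1; have := generalized_J_gen j; rewrite kj1.
have {zE} := zE (enum 'I_p); rewrite -[X in E _ X]big_filter.
rewrite -J_center_enum.
have: (size [seq j <- enum 'I_p | P j] <= 2)%N.
  rewrite size_filter; apply: leq_trans two.
  by rewrite -[X in (_ <= count _ X)%N]map_tnth_enum [X in (_ <=
    X)%N]count_map; apply: leqnn.
have: i \in [seq j <- enum 'I_p | P j] by rewrite mem_filter /P ki1 mem_enum.
have: all P [seq j <- enum 'I_p | P j] by apply: filter_all.
have: uniq [seq j <- enum 'I_p | P j] by rewrite filter_uniq ?enum_uniq.
case: [seq j <- enum 'I_p | P j] => [|a [|b []]] //=.
  by rewrite !inE !big_seq1 => _ _ /eqP <- _ zs; exists 1%N.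
rewrite !inE !andbT big_cons big_seq1 => ab /andP[Pa Pb] iab _ zE.
(* [v] is congruent to [s b], and unlike [s b] it commutes with [s a] exactly, so that powers of
   [z = s a * v] can be expanded. *)
pose v := (s a)^-1 * J_center K.
have Ev : E v (s b) by have := EM (Erefl (s a)^-1) zE; rewrite mulKg.
have zv : J_center K = s a * v by rewrite mulVKg.
have av : commute (s a) v.
  by rewrite /v /commute mulVKg -mulgA (J_centerC (s a)) mulKg.
have cab : coprime (tnth K' a) (tnth K' b) by apply: cop.
have EXab n : E (J_center K ^+ n) (s a ^+ n * s b ^+ n).
  by rewrite zv expgMn //; apply: EM => //; apply: EX.
have [/eqP ->|/eqP ->] := orP iab.
- have t1 := chinese_modl cab 1 0; have t0 := chinese_modr cab 1 0.
  move: (chinese _ _ _ _) t1 t0 => n n1 n0; exists n.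
  apply: Etrans (EXab n) _; rewrite -[X in E _ X]mulg1; apply: EM.
    by apply: Esym; apply: Egen1 => //; apply: gt1.
  by apply: Esym; apply: E1; apply: generalized_J_gen_dvd; rewrite /dvdn n0 mod0n.
- have t1 := chinese_modl cab 0 1; have t0 := chinese_modr cab 0 1.
  move: (chinese _ _ _ _) t1 t0 => n n0 n1; exists n.
  apply: Etrans (EXab n) _; rewrite -[X in E _ X]mul1g; apply: EM.
    by apply: Esym; apply: E1; apply: generalized_J_gen_dvd; rewrite /dvdn n0 mod0n.
  by apply: Esym; apply: Egen1 => //; apply: gt1.
Qed.

Lemma generalized_J_conj x g : reduced K K' -> exists2 w, W w & x ^ g = x ^ w.
Proof.
move=> red; have [w [c [Ww Zc ->]]] := generalized_J_decomp g red.
exists w => //; rewrite conjgM; apply: (mulgI c).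
by rewrite -conjgC (Zc.1 (x ^ w)).
Qed.

Lemma central_generalized_J c :
  reduced K K' -> (forall w, W w -> commute c w) -> forall g, commute c g.
Proof.
move=> red cW g; have [w [d [Ww Zd ->]]] := generalized_J_decomp g red.
by apply: commuteM; [apply: cW|apply: commute_sym; apply: Zd.1].
Qed.

End GeneralizedJ.

(* [generalized_J K K' x] unfolds to a product, which confuses the automatic
   declaration of implicit arguments. *)
Arguments generalized_J1 {p} K K'.
Arguments generalized_JX {p K K' x} n _.

(** * Transfer of homomorphisms along an isomorphism *)

Section Transfer.
Local Open Scope group_scope.

Definition kills_center p (K : p.-tuple natoo) (K' : p.-tuple nat)
    (H : groupType) (f : J K -> H) : Prop :=
  forall c, generalized_J K K' c ->
    (forall w, generalized_J K K' w -> commute c w) -> f c = 1.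

(** For adapted [k], such a tuple is a homomorphism from [J K] that sends [z] to 1 and whose
    restriction to [W] factors through [W] modulo its center. *)
Definition orbifold_tuple p (K : p.-tuple natoo) (K' : p.-tuple nat)
    (k : 'I_p -> nat) (H : groupType) (x : 'I_p -> H) : Prop :=
  [/\ forall i, x i ^+ k i = 1, \prod_(i < p) x i = 1
    & kills_center K' (@J_lift p K H x)].

(** The relations [x i ^+ k i = 1] then imply the torsion relations of [J K]; at an infinite entry
    every [k i] is allowed. *)
Definition adapted p (K : p.-tuple natoo) (k : 'I_p -> nat) : Prop :=
  forall i n, tnth K i = Some n -> (k i %| n)%N.

Section OneGroup.
Variables (p : nat) (K : p.-tuple natoo) (k : 'I_p -> nat).
Hypothesis Kk : adapted K k.
Variables (H : groupType) (x : 'I_p -> H).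
Hypothesis xk : forall i, x i ^+ k i = 1.
Hypothesis xz : \prod_(i < p) x i = 1.

Lemma orbifold_liftM : {morph (@J_lift p K H x) : u v / u * v}.
Proof.
apply: J_liftM => [i|i n /Kk/dvdnP[m ->]]; first by rewrite xz;
  exact/commute_sym/commute1.
by rewrite mulnC expgnA xk expg1n.
Qed.

Lemma orbifold_lift_gen i : J_lift x (J_gen K i) = x i.
Proof.
apply: J_lift_gen => [j|j n /Kk/dvdnP[m ->]]; first by rewrite xz;
  exact/commute_sym/commute1.
by rewrite mulnC expgnA xk expg1n.
Qed.

Lemma orbifold_lift_center : J_lift x (J_center K) = 1.
Proof.
rewrite (morph_bigprod orbifold_liftM) -[RHS]xz.
by apply: eq_bigr => i _; apply: orbifold_lift_gen.
Qed.

Lemma orbifold_lift_in_center (c : J K) : in_center c -> J_lift x c = 1.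
Proof. by case=> _; apply; [apply: orbifold_liftM|apply: orbifold_lift_center]. Qed.

End OneGroup.

(* The last clause says that the relators [s_i ^ k i] on the side of [K] kill
   the relators [t_j ^ l j] on the side of [L]. *)
Definition transfers p q (K : p.-tuple natoo) (K' : p.-tuple nat)
    (L : q.-tuple natoo) (L' : q.-tuple nat)
    (k : 'I_p -> nat) (l : 'I_q -> nat) (f : J K -> J L) (g : J L -> J K) : Prop :=
  [/\ forall x y, generalized_J K K' x -> generalized_J K K' y -> f (x * y) = f
    x * f y,
      forall x, generalized_J K K' x -> generalized_J L L' (f x),
      forall x, generalized_J K K' x -> g (f x) = x,
      adapted K k
    & forall j, generalized_J L L' (J_gen L j ^+ l j) /\
        exists i t h, powers (J_gen K i ^+ k i) t /\ g (J_gen L j ^+ l j) = t ^ h].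

Section TransferTuple.
Variables (p q : nat) (K : p.-tuple natoo) (K' : p.-tuple nat).
Variables (L : q.-tuple natoo) (L' : q.-tuple nat).
Variables (k : 'I_p -> nat) (l : 'I_q -> nat) (f : J K -> J L) (g : J L -> J K).
Hypothesis tf : transfers K' L' k l f g.
Hypothesis tg : transfers L' K' l k g f.
Hypothesis redL : reduced L L'.
Local Notation W1 := (generalized_J K K').
Local Notation W2 := (generalized_J L L').

Variable w2 : 'I_q -> J L.
Hypothesis w2P : forall j, W2 (w2 j) /\ exists2 c, in_center c & J_gen L j = w2
  j * c.

(** [g] is meaningful on [W2] only, so the generator is replaced by its part [w2 j] in [W2] and its
    central factor is sent to 1. *)
Definition transfer_tuple (H : groupType) (x : 'I_p -> H) (j : 'I_q) : H :=
  J_lift x (g (w2 j)).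

Section OneTuple.
Variables (H : groupType) (x : 'I_p -> H).
Hypothesis goodx : orbifold_tuple K K' k x.

Let Kk : adapted K k. Proof. by have [_ _ _ Kk _] := tf. Qed.
Let Ll : adapted L l. Proof. by have [_ _ _ Ll _] := tg. Qed.
Let xk i : x i ^+ k i = 1. Proof. by have [xk _ _] := goodx. Qed.
Let xz : \prod_(i < p) x i = 1. Proof. by have [_ xz _] := goodx. Qed.
Let xM : {morph (@J_lift p K H x) : u v / u * v}.
Proof. exact: (orbifold_liftM Kk xk xz). Qed.

Let gM u v : W2 u -> W2 v -> g (u * v) = g u * g v.
Proof. by have [gM _ _ _ _] := tg; apply: gM. Qed.

Let gW u : W2 u -> W1 (g u).
Proof. by have [_ gW _ _ _] := tg; apply: gW. Qed.

Let theta w := J_lift x (g w).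

Let thetaM u v : W2 u -> W2 v -> theta (u * v) = theta u * theta v.
Proof. by move=> Wu Wv; rewrite /theta gM // xM. Qed.

Let theta1 : theta 1 = 1.
Proof. by apply: (mulgI (theta 1)); rewrite -thetaM ?mulg1 //;
  apply: generalized_J1. Qed.

Let thetaV u : W2 u -> theta u^-1 = (theta u)^-1.
Proof.
move=> Wu; apply: (mulgI (theta u)); rewrite -thetaM ?mulgV ?theta1 //.
exact: generalized_JV.
Qed.

Let thetaX u n : W2 u -> theta (u ^+ n) = theta u ^+ n.
Proof.
move=> Wu; elim: n => [|n IHn]; first by rewrite theta1.
by rewrite !expgS thetaM ?IHn //; apply: generalized_JX.
Qed.

Let theta_center c : W2 c -> (forall u, commute c u) -> theta c = 1.
Proof.
move=> Wc cC; case: goodx => _ _; apply; first exact: gW.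
move=> w Ww; case: tf => fM fW gf _ _.
rewrite /commute -(gf _ Ww) -!gM; [|exact: fW|by []|by []|exact: fW].
by rewrite (cC (f w)).
Qed.

(** The part in [W2] of an element of [J L] is unique up to central elements of [W2], and [theta]
    kills these. *)
Let theta_eq u c v d : W2 u -> in_center c -> W2 v -> in_center d ->
  u * c = v * d -> theta u = theta v.
Proof.
move=> Wu Zc Wv Zd uv; have uE : u = v * (d * c^-1) by rewrite mulgA -uv mulgK.
have Zdc : in_center (d * c^-1) by apply: in_centerM => //; apply: in_centerV.
have Wdc : W2 (d * c^-1).
  have -> : d * c^-1 = v^-1 * u by rewrite uE mulKg.
  by apply: generalized_JM => //; apply: generalized_JV.
by rewrite uE thetaM // (theta_center Wdc Zdc.1) mulg1.
Qed.

Let ws_dec (r : seq 'I_q) : W2 (\prod_(j <- r) w2 j) /\ exists2 c, in_center c &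
  \prod_(j <- r) J_gen L j = (\prod_(j <- r) w2 j) * c.
Proof.
elim: r => [|j r [IHW [c Zc IHc]]].
  rewrite !big_nil; split; first exact: generalized_J1.
  by exists 1; [apply: in_center1|rewrite mulg1].
rewrite !big_cons; have [Wj [d Zd ->]] := w2P j.
split; first exact: generalized_JM.
exists (d * c); first exact: in_centerM.
by rewrite IHc !mulgA -(mulgA (w2 j) d) (Zd.1 _) !mulgA.
Qed.

Let theta_prod (r : seq 'I_q) :
  theta (\prod_(j <- r) w2 j) = \prod_(j <- r) transfer_tuple x j.
Proof.
elim: r => [|j r IHr]; first by rewrite !big_nil theta1.
rewrite !big_cons thetaM ?IHr //; first by case: (w2P j).
by case: (ws_dec r).
Qed.

(** The central element of [J L] has two decompositions, one with first factor the product of the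
    [w2 j] and one with first factor 1. *)
Lemma transfer_prod : \prod_(j < q) transfer_tuple x j = 1.
Proof.
rewrite -theta_prod -theta1.
have [Wr [c Zc rc]] := ws_dec (index_enum 'I_q).
apply: (theta_eq Wr Zc (generalized_J1 _ _) (d := J_center L)).
  exact: (in_centerX _ 1).
by rewrite -rc mul1g.
Qed.

Lemma transfer_exp j : transfer_tuple x j ^+ l j = 1.
Proof.
have [Wj [c Zc jc]] := w2P j.
have [Wl [i [t [h [[n tn] gt]]]]] : W2 (J_gen L j ^+ l j) /\
    exists i t h, powers (J_gen K i ^+ k i) t /\ g (J_gen L j ^+ l j) = t ^ h.
  by case: tf.
have Zcl : in_center (c ^+ l j).
  elim: (l j) => [|m IHm]; first exact: in_center1.
  by rewrite expgS; apply: in_centerM.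
have jl : J_gen L j ^+ l j = w2 j ^+ l j * c ^+ l j.
  by rewrite jc expgMn //; apply: commute_sym; apply: Zc.1.
rewrite -[transfer_tuple x j]/(theta (w2 j)) -thetaX //.
rewrite (theta_eq (generalized_JX _ Wj) Zcl Wl (in_center1 _));
  last by rewrite mulg1 jl.
rewrite /theta gt (morph_conj xM).
suff -> : J_lift x t = 1 by rewrite conj1g.
have xi1 : J_lift x (J_gen K i ^+ k i) = 1.
  by rewrite (morph_exp xM) (orbifold_lift_gen Kk) // xk.
by case: tn => ->; rewrite ?(morph_inv xM) (morph_exp xM) xi1 expg1n ?invg1.
Qed.

Let yM := orbifold_liftM Ll transfer_exp transfer_prod.

(** The induction runs over all of [J L], because the factors of an element of [W2] need not lie in
    [W2]; a decomposition is therefore carried along. *)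
Lemma transfer_lift_dec h w c : W2 w -> in_center c -> h = w * c ->
  J_lift (transfer_tuple x) h = J_lift x (g w).
Proof.
elim/J_ind: h w c => [|h1 h2 IH1 IH2|h IH|j] w c Ww Zc hE.
- rewrite (morph_one yM) -[RHS]/(theta w) -theta1.
  by apply: (theta_eq (generalized_J1 _ _) (in_center1 _) Ww Zc); rewrite mulg1.
- have [w1 [c1 [Ww1 Zc1 E1]]] := generalized_J_decomp h1 redL.
  have [w2' [c2 [Ww2 Zc2 E2]]] := generalized_J_decomp h2 redL.
  rewrite yM (IH1 _ _ Ww1 Zc1 E1) (IH2 _ _ Ww2 Zc2 E2).
  rewrite -!/(theta _) -thetaM //.
  apply: (theta_eq (generalized_JM Ww1 Ww2) (in_centerM Zc1 Zc2) Ww Zc).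
  by rewrite -hE E1 E2 !mulgA -(mulgA w1 c1) (Zc1.1 w2') !mulgA.
- have hE' : h = w^-1 * c^-1 by rewrite -invgM -(Zc.1 w) in hE *; rewrite -hE invgK.
  rewrite (morph_inv yM) (IH _ _ (generalized_JV Ww) (in_centerV Zc) hE').
  by rewrite -[J_lift x (g w^-1)]/(theta w^-1) thetaV // invgK.
rewrite (orbifold_lift_gen Ll transfer_exp transfer_prod).
have [Wj [d Zd jd]] := w2P j.
by apply: (theta_eq Wj Zd Ww Zc); rewrite -jd hE.
Qed.

Lemma transfer_lift w : W2 w -> J_lift (transfer_tuple x) w = J_lift x (g w).
Proof.
by move=> Ww; apply: (transfer_lift_dec Ww (in_center1 _)); rewrite mulg1.
Qed.

Lemma transfer_orbifold_tuple : orbifold_tuple L L' l (transfer_tuple x).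
Proof.
split; [exact: transfer_exp|exact: transfer_prod|].
move=> c Wc cC; rewrite transfer_lift // -/(theta c) theta_center //.
exact: central_generalized_J redL cC.
Qed.

Lemma transfer_lift_back w : W1 w -> J_lift (transfer_tuple x) (f w) = J_lift x w.
Proof.
by case: tf => fM fW gf _ _ Ww; rewrite transfer_lift ?gf //; apply: fW.
Qed.

End OneTuple.

(** Naturality in [H]. Applied to the projection of the affine group onto [qT], it makes the
    transfer of a lift a lift of the transferred tuple. *)
Lemma transfer_morph (H H' : groupType) (x : 'I_p -> H) (u : H -> H') j :
  {morph u : a b / a * b} -> orbifold_tuple K K' k x ->
  u (transfer_tuple x j) = transfer_tuple (u \o x) j.
Proof.
move=> uM [xk xz _].
have Kk : adapted K k by have [_ _ _ Kk _] := tf.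
have u1 : u 1 = 1 by apply: morph_one.
have uxk i : (u \o x) i ^+ k i = 1 by rewrite /= -(morph_exp uM) xk.
have uxz : \prod_(i < p) (u \o x) i = 1 by rewrite -(morph_bigprod uM) xz.
rewrite /transfer_tuple -[LHS]/((u \o @J_lift p K H x) _).
apply: (J_morph_eq (f := u \o @J_lift p K H x)) => [a b|a b|i] /=.
- by rewrite (orbifold_liftM Kk).
- by rewrite (orbifold_liftM Kk uxk).
- by rewrite !(orbifold_lift_gen Kk).
Qed.

End TransferTuple.
End Transfer.

(** * Equality of the rank sums on the two sides *)

Section LiftCounting.
Import GRing.Theory.
Local Open Scope group_scope.
Variables (F : finFieldType) (qT : finGroupType) (N : nat).
Variable rG : mx_representation F [set: qT] N.
Hypothesis qT_unit : (#|qT|%:R != 0 :> F)%R.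
Local Notation S a := (1%:M - rG a)%R.

Section Center.
Variables (p : nat) (K : p.-tuple natoo) (K' : p.-tuple nat) (k : 'I_p -> nat).
Hypothesis redK : reduced K K'.
Hypothesis Kk : adapted K k.
Hypothesis k_unit : forall i, ((k i)%:R != 0 :> F)%R.

(* A central element in the kernel of the projection to [qT] is mapped to a
   translation vector [d] fixed by the image; averaging the translation parts
   over the image gives a homomorphism to a vector space which vanishes on the
   torsion generators, hence [d = 0]. *)
Lemma affine_kills_center (x : 'I_p -> affine rG) :
  (forall i, x i ^+ k i = 1) -> \prod_(i < p) x i = 1 ->
  kills_center K' (@J_lift p K _ (snd \o x)) -> orbifold_tuple K K' k x.
Proof.
move=> xk xz killq; split=> // c Wc cW.
have psiM := orbifold_liftM Kk xk xz; set psi := J_lift x in psiM *.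
have xkq i : (snd \o x) i ^+ k i = 1.
  by rewrite /= -(morph_exp (@affine_snd_morph _ _ _ rG)) xk.
have xzq : \prod_(i < p) (snd \o x) i = 1.
  by rewrite -(morph_bigprod (@affine_snd_morph _ _ _ rG)) xz.
have qM := orbifold_liftM Kk xkq xzq.
have psi2 g : (psi g).2 = J_lift (snd \o x) g.
  apply: (J_morph_eq (f := snd \o psi)) => [u v|//|i] /=; first by rewrite psiM.
  by rewrite /psi !(orbifold_lift_gen Kk).
have psic2 : (psi c).2 = 1 by rewrite psi2 killq.
pose d := (psi c).1.
have cC : forall g, commute c g by apply: central_generalized_J redK cW.
have d_fix g : (d *m rG (psi g).2)%R = d.
  have := congr1 psi (cC g); rewrite !psiM => /(congr1 fst) /=.
  rewrite psic2 rG1 mulmx1 => /eqP.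
  by rewrite addrC (inj_eq (addrI _)) => /eqP.
pose Q0 := [set a : qT | `[< exists g, (psi g).2 = a >]].
have Q0P a : reflect (exists g, (psi g).2 = a) (a \in Q0).
  by rewrite finset.in_set; apply: asboolP.
have Q_group : group_set Q0.
  apply/group_setP; split=> [|a b].
    by apply/Q0P; exists 1; rewrite (morph_one psiM).
  move=> /Q0P[g <-] /Q0P[h <-]; apply/Q0P.
  by exists (g * h); rewrite psiM.
pose Q := Group Q_group.
have QP a : reflect (exists g, (psi g).2 = a) (a \in Q) := Q0P a.
pose e := (\sum_(a in Q) rG a)%R.
have Qe b : b \in Q -> (rG b *m e)%R = e.
  move=> Qb; rewrite mulmx_sumr [RHS](reindex_inj (mulgI b)) /=.
  by apply: eq_big => a; rewrite ?rGM // -[Q0]/(Q : {set qT}) groupMl.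
pose E g := ((psi g).1 *m e)%R.
have EM g h : E (g * h) = (E g + E h)%R.
  rewrite /E psiM affine_mulE /= mulmxDl -mulmxA Qe //.
  by apply/QP; exists h.
have E1 : E 1 = 0%R by rewrite /E (morph_one psiM) mul0mx.
have E0 g : E g = 0%R.
  elim/J_ind: g => [//|g h Eg Eh|g Eg|i]; first by rewrite EM Eg Eh addr0.
    by rewrite -[LHS]addr0 -{1}Eg -EM mulVg E1.
  have EX n : E (J_gen K i ^+ n) = (E (J_gen K i) *+ n)%R.
    by elim: n => [|n IHn]; rewrite ?E1 // expgS EM IHn mulrS.
  have := EX (k i); rewrite {1}/E (morph_exp psiM) /psi (orbifold_lift_gen Kk)
    // xk mul0mx.
  move/esym/eqP; rewrite -scaler_nat scaler_eq0 (negPf (k_unit i)) /=.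
  by move/eqP.
have de : (d *m e = #|Q|%:R *: d)%R.
  rewrite mulmx_sumr scaler_nat -sumr_const; apply: eq_bigr => a /QP[g <-].
  exact: d_fix.
have Q_unit : (#|Q|%:R != 0 :> F)%R.
  apply: contraNneq qT_unit => Qz; have /dvdnP[m] := cardSg (finset.subsetT Q).
  by rewrite cardsT => ->; rewrite natrM Qz mulr0.
have d0 : d = 0%R.
  by have := E0 c; rewrite /E -/d de => /eqP;
    rewrite scaler_eq0 (negPf Q_unit) => /eqP.
by rewrite -/psi [psi c]surjective_pairing psic2 -/d d0.
Qed.

Lemma sub1_rG_lift (xi : 'I_p -> qT) g :
  (forall i, xi i ^+ k i = 1) -> \prod_(i < p) xi i = 1 ->
  (S (J_lift xi (g : J K)) <= \sum_(i < p) S (xi i))%MS.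
Proof.
move=> xk xz; have xiM := orbifold_liftM Kk xk xz.
elim/J_ind: g => [|g h Sg Sh|g Sg|i].
- by rewrite (morph_one xiM) sub1_rG1.
- by rewrite xiM sub1_rGM.
- by rewrite (morph_inv xiM) sub1_rGV.
by rewrite (orbifold_lift_gen Kk) //; apply: (sumsmx_sup i).
Qed.

End Center.

Section Compare.
Variables (p q : nat) (K : p.-tuple natoo) (K' : p.-tuple nat).
Variables (L : q.-tuple natoo) (L' : q.-tuple nat).
Variables (k : 'I_p -> nat) (l : 'I_q -> nat) (f : J K -> J L) (g : J L -> J K).
Hypothesis tf : transfers K' L' k l f g.
Hypothesis tg : transfers L' K' l k g f.
Hypothesis redK : reduced K K'.
Hypothesis redL : reduced L L'.
Hypothesis k_unit : forall i, ((k i)%:R != 0 :> F)%R.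

Variables (w1 : 'I_p -> J K) (w2 : 'I_q -> J L).
Hypothesis w1P : forall i, generalized_J K K' (w1 i) /\
  exists2 c, in_center c & J_gen K i = w1 i * c.
Hypothesis w2P : forall j, generalized_J L L' (w2 j) /\
  exists2 c, in_center c & J_gen L j = w2 j * c.

Let Kk : adapted K k. Proof. by have [_ _ _ Kk _] := tf. Qed.
Let Ll : adapted L l. Proof. by have [_ _ _ Ll _] := tg. Qed.

Lemma orbifold_lift_part (H : groupType) (x : 'I_p -> H) i :
  orbifold_tuple K K' k x -> J_lift x (w1 i) = x i.
Proof.
move=> [xk xz _]; have [_ [c Zc sc]] := w1P i.
have := orbifold_lift_gen Kk xk xz i.
by rewrite sc (orbifold_liftM Kk xk xz) (orbifold_lift_in_center Kk xk xz Zc) mulg1.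
Qed.

Lemma transferK (H : groupType) (x : 'I_p -> H) i :
  orbifold_tuple K K' k x -> transfer_tuple f w1 (transfer_tuple g w2 x) i = x i.
Proof.
move=> gx; have [W1i _] := w1P i.
by rewrite /transfer_tuple (transfer_lift_back tf tg redL w2P gx W1i)
  orbifold_lift_part.
Qed.

Variable xi : 'I_p -> qT.
Hypothesis goodxi : orbifold_tuple K K' k xi.

(** Transfer along [g] maps lifts of [xi] to lifts of the transferred tuple, injectively since
    transfer along [f] leads back. *)
Lemma leq_card_lifts :
  (#|lifts rG xi k| <= #|lifts rG (transfer_tuple g w2 xi) l|)%N.
Proof.
pose x (v : {ffun 'I_p -> 'rV[F]_N}) i : affine rG := (v i, xi i).
have gx v : v \in lifts rG xi k -> orbifold_tuple K K' k (x v).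
  rewrite inE => /andP[/forallP xk /eqP xz].
  apply: (affine_kills_center redK Kk k_unit) => //; first by move=> i;
    apply/eqP; apply: xk.
  by have [_ _ killxi] := goodxi; apply: killxi.
pose T v := [ffun j => (transfer_tuple g w2 (x v) j).1].
have TE v : v \in lifts rG xi k ->
    forall j, transfer_tuple g w2 (x v) j = (T v j, transfer_tuple g w2 xi j)
      :> affine rG.
  move=> Lv j; have gv := gx v Lv; rewrite [LHS]surjective_pairing ffunE;
    congr pair.
  exact: (transfer_morph tf w2 j (@affine_snd_morph _ _ _ rG) gv).
rewrite -(card_in_imset (f := T)); last first.
  move=> v v' Lv Lv' TT; apply/ffunP=> i.
  have tt : transfer_tuple g w2 (x v) = transfer_tuple g w2 (x v').
    by apply/funext => j; rewrite !TE // TT.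
  have := transferK i (gx v Lv); rewrite tt transferK; last exact: gx.
  by case.
apply/subset_leq_card/fintype.subsetP=> _ /imsetP[v Lv ->].
have [yl yz _] := transfer_orbifold_tuple tf tg redL w2P (gx v Lv).
rewrite inE; apply/andP; split.
  by apply/forallP=> j; rewrite -TE // yl.
by under eq_bigr => j _ do rewrite -TE //; rewrite yz.
Qed.

End Compare.

Section RankEquality.
Variables (p q : nat) (K : p.-tuple natoo) (K' : p.-tuple nat).
Variables (L : q.-tuple natoo) (L' : q.-tuple nat).
Variables (k : 'I_p -> nat) (l : 'I_q -> nat) (f : J K -> J L) (g : J L -> J K).
Hypothesis tf : transfers K' L' k l f g.
Hypothesis tg : transfers L' K' l k g f.
Hypothesis redK : reduced K K'.
Hypothesis redL : reduced L L'.
Hypothesis k_unit : forall i, ((k i)%:R != 0 :> F)%R.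
Hypothesis l_unit : forall i, ((l i)%:R != 0 :> F)%R.

Variables (w1 : 'I_p -> J K) (w2 : 'I_q -> J L).
Hypothesis w1P : forall i, generalized_J K K' (w1 i) /\
  exists2 c, in_center c & J_gen K i = w1 i * c.
Hypothesis w2P : forall j, generalized_J L L' (w2 j) /\
  exists2 c, in_center c & J_gen L j = w2 j * c.

Variable xi : 'I_p -> qT.
Hypothesis goodxi : orbifold_tuple K K' k xi.

(** The two tuples have equally many lifts. They also generate the same subgroup, so the images of
    [1 - a] span the same space for both, and the sums of ranks are what remains in the count. *)
Lemma transfer_rank :
  (\sum_(i < p) \rank (S (xi i)) = \sum_(j < q) \rank (S (transfer_tuple g w2
    xi j)))%N.
Proof.
have Kk : adapted K k by have [_ _ _ Kk _] := tf.
have Ll : adapted L l by have [_ _ _ Ll _] := tg.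
set xi' := transfer_tuple g w2 xi.
have goodxi' : orbifold_tuple L L' l xi' := transfer_orbifold_tuple tf tg redL
  w2P goodxi.
have xiK i : transfer_tuple f w1 xi' i = xi i by apply: (transferK tf tg redL
  w1P w2P).
have [xk xz _] := goodxi; have [xl xz' _] := goodxi'.
have eq_lifts : #|lifts rG xi k| = #|lifts rG xi' l|.
  apply/eqP; rewrite eqn_leq.
  rewrite (leq_card_lifts tf tg redK redL k_unit w1P w2P goodxi) /=.
  have := leq_card_lifts tg tf redL redK l_unit w2P w1P goodxi'.
  by rewrite (_ : transfer_tuple f w1 xi' = xi) //; apply/funext.
have eq_rank : \rank (\sum_(i < p) S (xi i))%MS = \rank (\sum_(j < q) S (xi' j))%MS.
  apply/eqP; rewrite eqn_leq; apply/andP; split; apply: mxrankS;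
    apply/sumsmx_subP => i _.
    by rewrite -xiK /transfer_tuple; apply: (sub1_rG_lift Ll _ xl xz').
  by rewrite /xi' /transfer_tuple; apply: (sub1_rG_lift Kk _ xk xz).
have := card_lifts rG xk xz k_unit; rewrite eq_lifts eq_rank.
rewrite (card_lifts rG xl xz' l_unit) => /eqP.
have F_gt1 : (1 < #|F|)%N := finRing_gt1 F.
by rewrite (eqn_exp2l _ _ F_gt1) => /eqP ->.
Qed.

End RankEquality.
End LiftCounting.

(** * Orders of the generators in finite quotients *)

Section CyclicOrderInvariant.
Local Open Scope group_scope.

Lemma generalized_J_parts p (K : p.-tuple natoo) (K' : p.-tuple nat) :
  reduced K K' -> exists w : 'I_p -> J K, forall i, generalized_J K K' (w i) /\
    exists2 c, in_center c & J_gen K i = w i * c.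
Proof.
move=> red.
suff /boolp.choice[w wP] : forall i, exists w, generalized_J K K' w /\
    exists2 c, in_center c & J_gen K i = w * c by exists w.
move=> i; have [w [c [Ww Zc ->]]] := generalized_J_decomp (J_gen K i) red.
by exists w; split=> //; exists c.
Qed.

(** Dividing the group generated by the reflections by its center makes their product trivial. It
    also kills the center of [W], which is central in [J K] and so has central image. *)
Lemma exists_orbifold_tuple p (K : p.-tuple natoo) (K' : p.-tuple nat) k :
  reduced K K' -> adapted K k -> (forall i, 0 < k i)%N ->
  (2 < #|[set i | (1 < k i)%N]%SET|)%N ->
  exists (qT : finGroupType) (xi : 'I_p -> qT),
    orbifold_tuple K K' k xi /\ forall i, #[xi i] = k i.
Proof.
move=> red Kk k_gt0 k3; have [gT [x [xk xz xC]]] := reflection_rep k_gt0 k3.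
pose I := <<[set x i | i : 'I_p]>>%G.
have xI i : x i \in I by apply: mem_gen; apply: imset_f.
have ZP u : u \in I -> (forall j, commute u (x j)) -> u \in 'Z(I).
  move=> Iu uC; rewrite inE Iu /= cent_gen; apply/centP=> _ /imsetP[j _ ->].
  exact: uC.
have IN : I \subset 'N('Z(I)) by apply: char_norm; apply: center_char.
have xN i : x i \in 'N('Z(I)) by apply: (fintype.subsetP IN).
pose xi i := coset 'Z(I) (x i).
have xzI : \prod_(i < p) x i \in I by apply: group_prod => i _.
have xik i : xi i ^+ k i = 1 by rewrite -morphX ?xk ?morph1.
have xiz : \prod_(i < p) xi i = 1.
  rewrite -(morph_prod (coset_morphism 'Z(I))) => [|i _]; last exact: xN.
  by apply: coset_id; apply: ZP.
exists (coset_of 'Z(I)), xi; split; last first.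
  move=> i; apply/eqP; rewrite eqn_dvd order_dvdn xik eqxx /=.
  apply: xC => j; have : xi i ^+ #[xi i] = 1 by rewrite expg_order.
  rewrite -morphX // => /(coset_idr (groupX _ (xN i))).
  by rewrite inE => /andP[_ /centP xZ]; apply: xZ.
split=> // c Wc cW.
have xk' i n : tnth K i = Some n -> x i ^+ n = 1.
  by move=> /Kk/dvdnP[m ->]; rewrite mulnC expgnA xk expg1n.
have xM := J_liftM xz xk'.
have liftI u : @J_lift p K _ x u \in I.
  elim/J_ind: u => [|u v Iu Iv|u Iu|i]; first by rewrite (morph_one xM) group1.
  - by rewrite xM groupM.
  - by rewrite (morph_inv xM) groupV.
  - by rewrite (J_lift_gen xz xk').
have -> : J_lift xi c = coset 'Z(I) (J_lift x c).
  apply: (J_morph_eq (f := @J_lift p K _ xi) (g := fun u => coset 'Z(I) (J_lift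
    x u))).
  - exact: (orbifold_liftM Kk xik xiz).
  - by move=> u v; rewrite xM morphM //; apply: (fintype.subsetP IN).
  - by move=> i; rewrite (orbifold_lift_gen Kk xik xiz) (J_lift_gen xz xk').
apply: coset_id; apply: ZP => // j; rewrite -(J_lift_gen xz xk' j) /commute -!xM.
by congr J_lift; apply: central_generalized_J red cW _.
Qed.

(** On the side of [K] the orders are exact by the choice of [xi]; on the side of [L] the
    transferred elements are only known to have orders [e j] dividing [l j]. *)
Lemma transfer_orders p q (K : p.-tuple natoo) (K' : p.-tuple nat)
    (L : q.-tuple natoo) (L' : q.-tuple nat)
    (k : 'I_p -> nat) (l : 'I_q -> nat) (f : J K -> J L) (g : J L -> J K) :
  transfers K' L' k l f g -> transfers L' K' l k g f ->
  reduced K K' -> reduced L L' ->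
  (forall i, 0 < k i)%N -> (forall j, 0 < l j)%N ->
  (2 < #|[set i | (1 < k i)%N]%SET|)%N ->
  exists e : 'I_q -> nat, (forall j, e j %| l j)%N /\
    forall m, (1 < m)%N ->
      #|[set i | k i == m]%SET| = #|[set j | e j == m]%SET|.
Proof.
move=> tf tg redK redL k_gt0 l_gt0 k3.
have [_ _ _ Kk _] := tf.
have [qT [xi [goodxi xi_order]]] := exists_orbifold_tuple redK Kk k_gt0 k3.
have [w1 w1P] := generalized_J_parts redK;
  have [w2 w2P] := generalized_J_parts redL.
exists (fun j => #[transfer_tuple g w2 xi j]); split=> [j|m m1].
  have [yl _ _] := transfer_orbifold_tuple tf tg redL w2P goodxi.
  by rewrite order_dvdn yl.
(* A characteristic above this bound makes [#|qT|] and all the orders invertible. *)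
pose M := (#|qT| + (\sum_i k i + \sum_j l j))%N.
pose r := s2val (prime_above M).
have rM : (M < r)%N := s2valP (prime_above M).
have r_pr : prime r := s2valP' (prime_above M).
have unit_r n : (0 < n <= M)%N -> (n%:R != 0 :> 'F_r)%R.
  move=> /andP[n0 nM]; rewrite -(GRing.dvdn_pcharf (pchar_Fp r_pr)).
  by rewrite gtnNdvd // (leq_ltn_trans nM).
have k_unit i : ((k i)%:R != 0 :> 'F_r)%R.
  apply: unit_r; rewrite k_gt0 /M (bigD1 i) //= -addnA addnCA leq_addr //.
have l_unit j : ((l j)%:R != 0 :> 'F_r)%R.
  apply: unit_r; rewrite l_gt0 /M [(\sum_j l j)%N](bigD1 j) //= addnA addnCA
    leq_addr //.
have qT_unit : (#|qT|%:R != 0 :> 'F_r)%R.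
  by apply: unit_r; rewrite /M leq_addr andbT; apply/card_gt0P; exists 1.
have -> : #|[set i | k i == m]%SET| = #|[set i | #[xi i] == m]%SET|.
  by apply: eq_card => i; rewrite !finset.in_set xi_order.
apply: orbit_counts_orders => // C.
have rankE a : (#|rcosets C [set: qT]| - norbits C a)%N
    = \rank (1%:M - perm_module ('F_r) (acts_rcosets C _) a)%R.
  by have := perm_module_rank 'F_r (acts_rcosets C _) a => /(canRL (addnK _))/esym.
under eq_bigr => i _ do rewrite rankE.
under [RHS]eq_bigr => j _ do rewrite rankE.
exact: (transfer_rank _ qT_unit tf tg redK redL k_unit l_unit w1P w2P goodxi).
Qed.

End CyclicOrderInvariant.

(** * Comparison of multisets of orders *)

Section Counting.

Lemma eq_sum_counts (I I' : finType) (e : I -> nat) (e' : I' -> nat) (G : nat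
  -> nat) :
  (forall m, m <= 1 -> G m = 0) ->
  (forall m, 1 < m -> #|[set i | e i == m]%SET| = #|[set j | e' j == m]%SET|) ->
  \sum_i G (e i) = \sum_j G (e' j).
Proof.
move=> G0 E; pose B := (\sum_i e i + \sum_j e' j).+1.
have sumE (I0 : finType) (d : I0 -> nat) : (forall i, d i < B) ->
    \sum_i G (d i) = \sum_(m < B) #|[set i | d i == m]%SET| * G m.
  move=> dB; rewrite (partition_big (fun i => Ordinal (dB i)) xpredT) //=.
  apply: eq_bigr => m _; rewrite -sum_nat_const; apply: eq_big => [i|i /eqP <- //].
  by rewrite finset.in_set -val_eqE.
rewrite (sumE _ e) => [|i]; last by rewrite ltnS (bigD1 i) //= -addnA leq_addr.
rewrite (sumE _ e') => [|j];
  last by rewrite ltnS addnC (bigD1 j) //= -addnA leq_addr.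
apply: eq_bigr => m _; have [m1|m1] := leqP m 1; first by rewrite G0 // !muln0.
by rewrite E.
Qed.

Lemma card_sum (I : finType) (P : pred I) : #|[set i | P i]%SET| = \sum_i P i.
Proof.
rewrite -sum1_card big_mkcond /=; apply: eq_bigr => i _.
by rewrite finset.in_set; case: ifP.
Qed.

Lemma eq_card_gt1 (I I' : finType) (e : I -> nat) (e' : I' -> nat) :
  (forall m, 1 < m -> #|[set i | e i == m]%SET| = #|[set j | e' j == m]%SET|) ->
  #|[set i | 1 < e i]%SET| = #|[set j | 1 < e' j]%SET|.
Proof.
by move=> E; rewrite !card_sum;
  apply: (eq_sum_counts (G := fun m => 1 < m)) => // -[|[]].
Qed.

Lemma leq_card_gt1_dvdn (I : finType) (e d : I -> nat) :
  (forall i, 0 < d i) -> (forall i, e i %| d i) ->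
  #|[set i | 1 < e i]%SET| <= #|[set i | 1 < d i]%SET|.
Proof.
move=> d_gt0 ed; apply: subset_leq_card; apply/fintype.subsetP=> i.
by rewrite !finset.in_set => ei; apply: leq_trans ei (dvdn_leq _ _).
Qed.

End Counting.

Section TransferCounts.
Local Open Scope group_scope.
Variables (p q : nat) (K : p.-tuple natoo) (K' : p.-tuple nat).
Variables (L : q.-tuple natoo) (L' : q.-tuple nat).
Variables (k : 'I_p -> nat) (l : 'I_q -> nat) (f : J K -> J L) (g : J L -> J K).
Hypothesis tf : transfers K' L' k l f g.
Hypothesis tg : transfers L' K' l k g f.
Hypothesis redK : reduced K K'.
Hypothesis redL : reduced L L'.
Hypothesis k_gt0 : forall i, (0 < k i)%N.
Hypothesis l_gt0 : forall j, (0 < l j)%N.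

(** With a hypothesis on one side only, this excludes that killing a class leaves at least three
    nontrivial orders on one side and fewer on the other. *)
Lemma transfer_leq_gt1 : (2 < #|[set i | 1 < k i]%SET|)%N ->
  (#|[set i | 1 < k i]%SET| <= #|[set j | 1 < l j]%SET|)%N.
Proof.
move=> k3; have [e [el ke]] := transfer_orders tf tg redK redL k_gt0 l_gt0 k3.
by rewrite (eq_card_gt1 ke); apply: leq_card_gt1_dvdn.
Qed.

(** The entries [e j] divide [l j], and symmetrically. Summing the entries greater than 1 in both
    directions forces equality of the sums, hence [e j = l j] whenever one of them exceeds 1. *)
Lemma transfer_counts :
  (2 < #|[set i | 1 < k i]%SET|)%N -> (2 < #|[set j | 1 < l j]%SET|)%N ->
  forall m, (1 < m)%N -> #|[set i | k i == m]%SET| = #|[set j | l j == m]%SET|.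
Proof.
move=> k3 l3 m m1.
have [e [el ke]] := transfer_orders tf tg redK redL k_gt0 l_gt0 k3.
have [e' [ek le]] := transfer_orders tg tf redL redK l_gt0 k_gt0 l3.
pose G n := if (1 < n)%N then n else 0%N.
have G0 n : (n <= 1)%N -> G n = 0%N by rewrite /G ltnNge => ->.
have Gle a b : (0 < b)%N -> (a %| b)%N -> (G a <= G b)%N.
  move=> b0 ab; rewrite /G; case: ifP => // a1; have le_ab := dvdn_leq b0 ab.
  by rewrite (leq_trans a1).
have := leqif_sum (fun j (_ : xpredT j) => leqif_eq (Gle _ _ (l_gt0 j) (el j))).
case=> _; rewrite -(eq_sum_counts G0 ke).
have -> : \sum_i G (k i) == \sum_j G (l j).
  rewrite eqn_leq; apply/andP; split.
    by rewrite (eq_sum_counts G0 ke); apply: leq_sum => j _; apply: Gle.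
  by rewrite (eq_sum_counts G0 le); apply: leq_sum => i _; apply: Gle.
move/esym/forallP=> Ge; rewrite (ke m m1); apply: eq_card => j.
rewrite !finset.in_set; have /eqP := Ge j; rewrite /G.
case: (ltnP 1 (e j)) => e1; case: (ltnP 1 (l j)) => l1 //.
- by move=> ->.
- by move=> e0; rewrite e0 in e1.
- by move=> l0; rewrite -l0 in l1.
- by move=> _; rewrite !ltn_eqF // (leq_ltn_trans _ m1).
Qed.

End TransferCounts.

(** * Characters and the exact orders of the generators *)

Section GeneratorOrders.
Local Open Scope group_scope.

(** The coordinate at [i] of the abelianization of [J K], reduced modulo [m]. At an infinite entry
    every positive [m] is available, so finite targets suffice. *)
Lemma J_character p (K : p.-tuple natoo) i m : (0 < m)%N ->
  (forall n, tnth K i = Some n -> m %| n)%N ->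
  exists (A : groupType) (chi : J K -> A),
  [/\ {morph chi : x y / x * y}, forall x y, commute (chi x) (chi y),
      forall j, j != i -> chi (J_gen K j) = 1
    & forall n, (chi (J_gen K i) ^+ n == 1) = (m %| n)%N].
Proof.
case: m => // m _ mK; pose h (j : 'I_p) : 'I_m.+1 := if j == i then Zp1 else 1.
have hC (x y : 'I_m.+1) : commute x y by apply: Zp_mulgC.
have hk j n : tnth K j = Some n -> h j ^+ n = 1.
  rewrite /h; case: eqP => [->|_ _]; last by rewrite expg1n.
  move/mK=> mn; apply/eqP; rewrite -order_dvdn.
  by rewrite order_Zp1.
exists 'I_m.+1, (J_lift h); split=> //.
- exact: J_liftM.
- by move=> j ji; rewrite J_lift_gen // /h (negPf ji).
- by move=> n; rewrite J_lift_gen // /h eqxx -order_dvdn order_Zp1.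
Qed.

Lemma J_gen_exp_eq1 p (K : p.-tuple natoo) i n :
  (forall k, tnth K i = Some k -> 0 < k)%N ->
  J_gen K i ^+ n = 1 <-> (if tnth K i is Some k then k %| n else n == 0)%N.
Proof.
move=> k_gt0; split; last first.
  case Ki: (tnth K i) => [k|]; last by move/eqP->.
  by case/dvdnP=> m ->; rewrite mulnC expgnA (J_gen_exp Ki) expg1n.
case Ki: (tnth K i) => [k|] sn.
  have [|A [chi [chiM _ _ chi1]]] := @J_character p K i k (k_gt0 _ Ki).
    by rewrite Ki => n0 [->].
  by rewrite -chi1 -(morph_exp chiM) sn (morph_one chiM).
(* For an infinite order, the character modulo [n.+1] detects every nonzero [n]. *)
have [|A [chi [chiM _ _ chi1]]] := @J_character p K i n.+1 isT; first by rewrite Ki.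
have := chi1 n; rewrite -(morph_exp chiM) sn (morph_one chiM) eqxx => /esym dn.
by case: posnP => // n0; have := dvdn_leq n0 dn; rewrite ltnn.
Qed.

Lemma J_gen_exp_characters p (K : p.-tuple natoo) i n :
  (forall k, tnth K i = Some k -> 0 < k)%N ->
  (forall m, 0 < m -> (forall k, tnth K i = Some k -> m %| k) -> m %| n)%N ->
  J_gen K i ^+ n = 1.
Proof.
move=> k_gt0 H; apply/(J_gen_exp_eq1 _ k_gt0); case Ki: (tnth K i) => [k|].
  by apply: H; [apply: k_gt0|rewrite Ki => m [->]].
have dn : (n.+1 %| n)%N by apply: H => //; rewrite Ki.
by case: posnP => // n0; have := dvdn_leq n0 dn; rewrite ltnn.
Qed.

End GeneratorOrders.

(** * Reflection isomorphisms *)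

Section ReflectionIsomorphisms.
Local Open Scope group_scope.

(** One direction of the isomorphism; the other is the same property with [f] and [g] exchanged, so
    that each consequence is available on both sides. *)
Definition ref_pair p q (K : p.-tuple natoo) (K' : p.-tuple nat)
    (L : q.-tuple natoo) (L' : q.-tuple nat) (f : J K -> J L) (g : J L -> J K)
      : Prop :=
  [/\ forall x y, generalized_J K K' x -> generalized_J K K' y -> f (x * y) = f
    x * f y,
      forall x, generalized_J K K' x -> generalized_J L L' (f x),
      forall x, generalized_J K K' x -> g (f x) = x
    & forall r, reflections K K' r -> reflections L L' (f r)].

Lemma ref_iso_pair p q (K : p.-tuple natoo) (K' : p.-tuple nat)
    (L : q.-tuple natoo) (L' : q.-tuple nat) :
  ref_iso K K' L L' -> exists (f : J K -> J L) (g : J L -> J K),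
    ref_pair K' L' f g /\ ref_pair L' K' g f.
Proof.
case=> f [fM [fW f_inj f_surj] fR].
have /boolp.choice[g gP] : forall y, exists x, generalized_J L L' y ->
    generalized_J K K' x /\ f x = y.
  move=> y; have [Wy|nWy] := pselect (generalized_J L L' y); last by exists 1.
  by have [x Wx <-] := f_surj _ Wy; exists x.
have gf x : generalized_J K K' x -> g (f x) = x.
  move=> Wx; have [Wg fg] := gP _ (fW _ Wx).
  by apply: f_inj; rewrite ?inE.
exists f, g; split; split=> //.
- by move=> r Rr; rewrite -fR; exists r.
- move=> x y Wx Wy; have [Wgx fgx] := gP _ Wx; have [Wgy fgy] := gP _ Wy.
  rewrite -{1}fgx -{1}fgy -fM // gf //; exact: generalized_JM.
- by move=> y /gP[].
- by move=> y /gP[].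
- move=> r; rewrite -fR => -[x Rx <-]; rewrite gf //; exact: reflectionsP.
Qed.

Lemma ref_pair_iso p q (K : p.-tuple natoo) (K' : p.-tuple nat)
    (L : q.-tuple natoo) (L' : q.-tuple nat) (f : J K -> J L) (g : J L -> J K) :
  ref_pair K' L' f g -> ref_pair L' K' g f -> ref_iso K K' L L'.
Proof.
move=> [fM fW gf fR] [gM gW fg gR]; exists f; split=> //.
- split=> [x|x y|y]; first exact: fW.
    by rewrite !inE => Wx Wy fxy; rewrite -(gf x) // -(gf y) // fxy.
  by move=> Wy; exists (g y); [apply: gW|apply: fg].
- apply/seteqP; split=> [_ [r Rr <-]|r Rr]; first exact: fR.
  by exists (g r); [apply: gR|apply: fg; apply: reflectionsP Rr].
Qed.

Section Pair.
Variables (p q : nat) (K : p.-tuple natoo) (K' : p.-tuple nat).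
Variables (L : q.-tuple natoo) (L' : q.-tuple nat) (f : J K -> J L) (g : J L ->
  J K).
Hypothesis fg : ref_pair K' L' f g.
Hypothesis redK : reduced K K'.
Hypothesis redL : reduced L L'.
Local Notation r i := (J_gen K i ^+ tnth K' i).
Local Notation r' j := (J_gen L j ^+ tnth L' j).
Local Notation W1 := (generalized_J K K').
Local Notation W2 := (generalized_J L L').

(** The conjugating element is required in [W2], where [g] is multiplicative; it can be found there
    because the central part of a conjugating element acts trivially. *)
Definition matched i j : Prop :=
  r' j <> 1 /\ exists t w, [/\ powers (r' j) t, W2 w & f (r i) = t ^ w].

Lemma pairM x y : W1 x -> W1 y -> f (x * y) = f x * f y.
Proof. by case: fg => fM _ _ _; apply: fM. Qed.

Lemma pair1 : f 1 = 1.
Proof.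
have W11 : W1 1 by apply: generalized_J1.
by apply: (mulgI (f 1)); rewrite -pairM // !mulg1.
Qed.

Lemma pairV x : W1 x -> f x^-1 = (f x)^-1.
Proof.
move=> Wx; apply: (mulgI (f x)); rewrite -pairM ?mulgV ?pair1 //.
exact: generalized_JV.
Qed.

Lemma pairX x n : W1 x -> f (x ^+ n) = f x ^+ n.
Proof.
move=> Wx; elim: n => [|n IHn]; first by rewrite pair1.
by rewrite !expgS pairM ?IHn //; apply: generalized_JX.
Qed.

Lemma pairJ x w : W1 x -> W1 w -> f (x ^ w) = f x ^ f w.
Proof.
move=> Wx Ww; rewrite !conjgE !pairM ?pairV //; first exact: generalized_JV.
exact: generalized_JM.
Qed.

Lemma pair_inj x y : W1 x -> W1 y -> f x = f y -> x = y.
Proof. by case: fg => _ _ gf _ Wx Wy E; rewrite -(gf x) // E gf. Qed.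

Lemma gen_reflection i : r i <> 1 -> reflections K K' (r i).
Proof.
move=> ri; exists i, (r i), 1; split=> //; last by rewrite conjg1.
by exists 1%N; left.
Qed.

Lemma exists_matched i : r i <> 1 -> exists j, matched i j.
Proof.
move=> ri; have [_ _ _ fR] := fg.
have [j [t [w [tr t1 E]]]] := fR _ (gen_reflection ri).
have [v Wv wv] := generalized_J_conj t w redL.
exists j; split; last by exists t, v; rewrite -wv.
move=> rj; case: tr t1 => n; rewrite rj => -[] ->; by rewrite expg1n ?invg1.
Qed.

Lemma matched_exp i j n : matched i j -> r' j ^+ n = 1 -> r i ^+ n = 1.
Proof.
move=> [_ [t [w [[m tm] _ E]]]] rn; apply: pair_inj.
- by apply: generalized_JX; apply: generalized_J_gen.
- exact: generalized_J1.
rewrite pair1 pairX; last exact: generalized_J_gen.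
rewrite E -conjXg; suff -> : t ^+ n = 1 by rewrite conj1g.
by case: tm => ->; rewrite ?expVgn expgnAC rn expg1n ?invg1.
Qed.

End Pair.

Lemma powersX (G : groupType) (x t : G) n : powers x t -> powers (x ^+ n) (t ^+ n).
Proof.
case=> m [->|->]; exists m; [left|right]; first by rewrite expgnAC.
by rewrite expVgn expgnAC.
Qed.

Section MatchedBack.
Variables (p q : nat) (K : p.-tuple natoo) (K' : p.-tuple nat).
Variables (L : q.-tuple natoo) (L' : q.-tuple nat) (f : J K -> J L) (g : J L ->
  J K).
Hypothesis fg : ref_pair K' L' f g.
Hypothesis gf : ref_pair L' K' g f.
Hypothesis redK : reduced K K'.
Hypothesis redL : reduced L L'.
Local Notation r i := (J_gen K i ^+ tnth K' i).
Local Notation r' j := (J_gen L j ^+ tnth L' j).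

(** Going forth and back shows that [r i] is conjugate to a power of [r i']. If [i != i'], every
    character at [i] kills [r i'], hence [r i], while these characters together detect [r i]. *)
Lemma matched_back i j i' : r i <> 1 ->
  matched K' L' f i j -> matched L' K' g j i' -> i = i'.
Proof.
move=> ri [_ [t [w [[m tm] Ww E]]]] [_ [u [v [un _ E']]]].
case: (eqVneq i i') => // ii'; case: ri.
have Wt : generalized_J L L' t.
  have Wm : generalized_J L L' (r' j ^+ m) by apply: generalized_JX;
    apply: generalized_J_gen.
  by case: tm => ->; [|apply: generalized_JV].
have [_ _ gfK _] := fg.
have {E} rE : r i = g t ^ g w by rewrite -(pairJ gf) // -E gfK //;
  apply: generalized_J_gen.
have char_dvd M : (0 < M)%N -> (forall n, tnth K i = Some n -> M %| n)%N ->
    (M %| tnth K' i)%N.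
  move=> M0 MK; have [A [chi [chiM chiC chi0 chi1]]] := J_character M0 MK.
  have chiJ x h : chi (x ^ h) = chi x.
    by rewrite (morph_conj chiM) conjgE (chiC x h) mulKg.
  have chiu : chi u = 1.
    case: un => n un; have uns : chi (r i' ^+ n) = 1.
      rewrite !(morph_exp chiM) chi0 ?expg1n //; last by rewrite eq_sym.
    by case: un => ->; rewrite ?(morph_inv chiM) uns ?invg1.
  rewrite -chi1 -(morph_exp chiM) rE chiJ.
  have grm : chi (g (r' j ^+ m)) = 1.
    by rewrite (pairX gf) ?E' ?(morph_exp chiM) ?chiJ ?chiu ?expg1n //;
      apply: generalized_J_gen.
  case: tm => ->; rewrite ?(pairV gf) ?(morph_inv chiM) ?grm ?invg1 //.
  by apply: generalized_JX; apply: generalized_J_gen.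
have [[_ def] _ _] := redK; have [Kik _ _] := def i.
have k_gt0 k : tnth K i = Some k -> (0 < k)%N.
  by move=> Ki; rewrite Ki in Kik; apply: ltnW.
exact: J_gen_exp_characters k_gt0 char_dvd.
Qed.

End MatchedBack.
End ReflectionIsomorphisms.

(** * Orders of matched reflections and the resulting transfers *)

Section Matching.
Local Open Scope group_scope.

Section GeneratorPowers.
Variables (p : nat) (K : p.-tuple natoo) (K' : p.-tuple nat).
Hypothesis def : defining_tuples K K'.
Local Notation r i := (J_gen K i ^+ tnth K' i).

Definition refl_order i : natoo := divoo (tnth K i) (tnth K' i).

Lemma tuple_gt0 i k : tnth K i = Some k -> (0 < k)%N.
Proof. by have [_ /(_ i)[+ _ _]] := def => + Ki; rewrite Ki; apply: ltnW. Qed.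

Lemma refl_order_Some i k : tnth K i = Some k ->
  exists2 a, refl_order i = Some a & k = (tnth K' i * a)%N.
Proof.
have [_ /(_ i)[_ _]] := def; rewrite /refl_order => + Ki; rewrite Ki /= => k'k.
by exists (k %/ tnth K' i)%N => //; rewrite mulnC divnK.
Qed.

Lemma refl_order_gt0 i a : refl_order i = Some a -> (0 < a)%N.
Proof.
case Ki: (tnth K i) => [k|]; last by rewrite /refl_order Ki.
have [b -> kE] := refl_order_Some Ki; case=> <-.
by have := tuple_gt0 Ki; rewrite kE muln_gt0 => /andP[].
Qed.

Lemma gen_power_eq1 i n :
  r i ^+ n = 1 <-> (if refl_order i is Some a then a %| n else n == 0)%N.
Proof.
have [_ /(_ i)[_ k'_gt0 _]] := def.
rewrite -expgnA; have := J_gen_exp_eq1 (tnth K' i * n) (@tuple_gt0 i).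
case Ki: (tnth K i) => [k|] ->.
  by have [a -> ->] := refl_order_Some Ki; rewrite dvdn_pmul2l.
by rewrite /refl_order Ki /= muln_eq0 (gtn_eqF k'_gt0).
Qed.

Lemma gen_eq1 i : r i = 1 <-> refl_order i = Some 1%N.
Proof.
have := gen_power_eq1 i 1; rewrite expg1 => ->.
by case: refl_order => [a|] //; rewrite dvdn1; split=> [/eqP ->|[->]].
Qed.

(** The default 2 is greater than 1, so a nontrivial reflection stays nontrivial, and it depends
    only on the reflection order, on which matched generators agree. *)
Definition quot_order i : nat := odflt 2 (refl_order i).

Lemma quot_order_gt0 i : (0 < quot_order i)%N.
Proof. by rewrite /quot_order; case E: refl_order => [a|//];
  apply: refl_order_gt0 E. Qed.

Lemma quot_order_gt1 i : r i <> 1 -> (1 < quot_order i)%N.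
Proof.
move=> ri; rewrite ltn_neqAle quot_order_gt0 andbT; apply/eqP=> n1; apply: ri.
by apply/gen_eq1; move: n1; rewrite /quot_order; case: refl_order => [a|] //= <-.
Qed.

(* The order [k_i], where an infinite reflection order is cut down to 2. *)
Definition cut_order i : nat := (tnth K' i * quot_order i)%N.

Lemma cut_order_gt1 i : (1 < cut_order i)%N.
Proof.
have [_ /(_ i)[kgt k'_gt0 _]] := def; rewrite /cut_order /quot_order.
case Ki: (tnth K i) kgt => [k|] k1.
  by have [a -> E] := refl_order_Some Ki; rewrite -E.
by rewrite /refl_order Ki /= -[1%N]/(1 * 1)%N; case: (tnth K' i) k'_gt0.
Qed.

Lemma cut_order_gt0 i : (0 < cut_order i)%N.
Proof. exact: ltnW (cut_order_gt1 i). Qed.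

Lemma adapted_dvdn (n : 'I_p -> nat) :
  (forall i, n i %| quot_order i)%N -> adapted K (fun i => tnth K' i * n i)%N.
Proof.
move=> nq i k Ki; have [a aE ->] := refl_order_Some Ki.
have [_ /(_ i)[_ k'_gt0 _]] := def; rewrite dvdn_pmul2l //.
by have := nq i; rewrite /quot_order aE.
Qed.

End GeneratorPowers.

Section Transfers.
Variables (p q : nat) (K : p.-tuple natoo) (K' : p.-tuple nat).
Variables (L : q.-tuple natoo) (L' : q.-tuple nat) (f : J K -> J L) (g : J L ->
  J K).
Hypothesis fg : ref_pair K' L' f g.
Hypothesis gf : ref_pair L' K' g f.
Hypothesis redK : reduced K K'.
Hypothesis redL : reduced L L'.
Local Notation r i := (J_gen K i ^+ tnth K' i).
Local Notation r' j := (J_gen L j ^+ tnth L' j).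

Lemma matched_sym i j : r i <> 1 -> matched K' L' f i j -> matched L' K' g j i.
Proof.
move=> ri ij; have [i' ji'] := exists_matched gf redK ij.1.
by rewrite (matched_back fg gf redK ri ij ji').
Qed.

Lemma matched_refl_order i j : r i <> 1 -> matched K' L' f i j ->
  refl_order K K' i = refl_order L L' j.
Proof.
move=> ri ij; have ji := matched_sym ri ij.
have [defK _ _] := redK; have [defL _ _] := redL.
have E n : r i ^+ n = 1 <-> r' j ^+ n = 1.
  by split; [apply: (matched_exp gf ji)|apply: (matched_exp fg ij)].
have {}E n : (if refl_order K K' i is Some a then a %| n else n == 0)%N
    <-> (if refl_order L L' j is Some a then a %| n else n == 0)%N.
  by rewrite -!gen_power_eq1.
have gtK := refl_order_gt0 defK (i := i); have gtL := refl_order_gt0 defL (i := j).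
case: (refl_order K K' i) (refl_order L L' j) E gtK gtL => [a|] [b|] // E gtK gtL.
- congr Some; apply/eqP; rewrite eqn_dvd.
  by apply/andP; split; apply/E.
- by have /E := dvdnn a; rewrite (gtn_eqF (gtK _ erefl)).
- by have := (E b).2 (dvdnn b); rewrite (gtn_eqF (gtL _ erefl)).
Qed.

(** The relators are powers of the [r i] and [r' j], so they lie in the subgroups on which [f] and
    [g] are defined; a common exponent at matched indices makes them correspond. *)
Lemma transfers_matched (n : 'I_p -> nat) (n' : 'I_q -> nat) :
  (forall i, n i %| quot_order K K' i)%N ->
  (forall i j, r' j <> 1 -> matched L' K' g j i -> n' j = n i) ->
  transfers K' L' (fun i => tnth K' i * n i)%N (fun j => tnth L' j * n' j)%N f g.
Proof.
have [defK _ _] := redK.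
move=> nq nn; have [fM fW gfK fR] := fg; split=> //; first exact: adapted_dvdn.
move=> j; split; first by apply: generalized_J_gen_dvd; apply: dvdn_mulr.
rewrite expgnA; have [rj|rj] := pselect (r' j = 1).
  have p_gt0 : (0 < p)%N by case: defK.
  exists (Ordinal p_gt0), 1, 1; split; first by exists 0%N; left.
  by rewrite rj expg1n (pair1 gf) conjg1.
have [i ji] := exists_matched gf redK rj.
have [ri [t [w [rt Ww E]]]] := ji.
exists i, (t ^+ n' j), w; split.
  by rewrite expgnA -(nn _ _ rj ji); apply: powersX.
by rewrite (pairX gf) ?E ?conjXg //; apply: generalized_J_gen.
Qed.

End Transfers.
End Matching.

(** * Recovery of the defining tuples *)

Section Recovery.
Local Open Scope group_scope.

Section OneMatch.
Variables (p q : nat) (K : p.-tuple natoo) (K' : p.-tuple nat).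
Variables (L : q.-tuple natoo) (L' : q.-tuple nat) (f : J K -> J L) (g : J L ->
  J K).
Hypothesis fg : ref_pair K' L' f g.
Hypothesis gf : ref_pair L' K' g f.
Hypothesis redK : reduced K K'.
Hypothesis redL : reduced L L'.
Hypothesis p3 : (2 < p)%N.
Hypothesis q3 : (2 < q)%N.
Local Notation r i := (J_gen K i ^+ tnth K' i).
Local Notation r' j := (J_gen L j ^+ tnth L' j).

Let defK : defining_tuples K K'. Proof. by case: redK. Qed.
Let defL : defining_tuples L L'. Proof. by case: redL. Qed.

Lemma matched_quot_order i j : r i <> 1 -> matched K' L' f i j ->
  quot_order K K' i = quot_order L L' j.
Proof.
by move=> ri ij; rewrite /quot_order (matched_refl_order fg gf redK redL ri ij).
Qed.

Lemma transfers_cut_order : transfers K' L' (cut_order K K') (cut_order L L') f g.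
Proof.
apply: (transfers_matched fg gf) => // i j rj ji; apply/esym.
by have := matched_refl_order gf fg redL redK rj ji; rewrite /quot_order => ->.
Qed.

(* The orders left after killing the reflections attached to [i0]. *)
Definition killed i0 i : nat :=
  (tnth K' i * if i == i0 then 1 else quot_order K K' i)%N.

Lemma killed_gt0 i0 i : (0 < killed i0 i)%N.
Proof.
have [_ /(_ i)[_ k'_gt0 _]] := defK; rewrite muln_gt0 k'_gt0 /=.
by case: ifP => // _; apply: quot_order_gt0.
Qed.

Lemma killed_neq i0 i : i != i0 -> killed i0 i = cut_order K K' i.
Proof. by rewrite /killed => /negPf ->. Qed.

Lemma killed_eq i0 : killed i0 i0 = tnth K' i0.
Proof. by rewrite /killed eqxx muln1. Qed.

Lemma card_cut_order : #|[set i | 1 < cut_order K K' i]%N%SET| = p.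
Proof.
rewrite -[RHS]card_ord -cardsT; apply: eq_card => i.
by rewrite !finset.in_set cut_order_gt1.
Qed.

(** Only the entry at [i0] can become 1, so fewer than three nontrivial orders are left in a single
    exceptional case. *)
Lemma card_killed i0 :
  (2 < #|[set i | 1 < killed i0 i]%N%SET|)%N || (p == 3) && (tnth K' i0 == 1%N).
Proof.
have E : #|[set i | 1 < killed i0 i]%N%SET| = ((1 < tnth K' i0) + p.-1)%N.
  rewrite card_sum (bigD1 i0) //= killed_eq; congr (_ + _)%N.
  rewrite (eq_bigr (fun=> 1%N)) => [|i ii0];
    last by rewrite killed_neq // cut_order_gt1.
  by rewrite sum1_card cardC1 card_ord.
rewrite E; have [_ /(_ i0)[_ + _]] := defK.
have -> : (p == 3) = ~~ (2 < p.-1)%N by case: p p3 => [|[|[|[|]]]].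
have p_gt0 : (0 < p)%N by do 2!apply: ltnW.
case: (tnth K' i0) => [|[|k']] //= _; first by rewrite add0n andbT orbN.
by rewrite add1n prednK // p3.
Qed.

Lemma transfers_killed i0 j0 : r i0 <> 1 -> matched K' L' f i0 j0 ->
  transfers K' L' (killed i0)
    (fun j => tnth L' j * if j == j0 then 1 else quot_order L L' j)%N f g.
Proof.
move=> ri0 ij0; apply: (transfers_matched fg gf) => // [i|i j rj ji];
  first by case: ifP; rewrite ?dvd1n.
have -> : (j == j0) = (i == i0).
  apply/eqP/eqP=> [jj0|ii0].
    by rewrite jj0 in ji; rewrite (matched_back fg gf redK ri0 ij0 ji).
  by rewrite ii0 in ji; rewrite (matched_back gf fg redL rj ji ij0).
case: ifP => // _; apply/esym.
by have := matched_refl_order gf fg redL redK rj ji; rewrite /quot_order => ->.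
Qed.

End OneMatch.
Section TwoSided.
Variables (p q : nat) (K : p.-tuple natoo) (K' : p.-tuple nat).
Variables (L : q.-tuple natoo) (L' : q.-tuple nat) (f : J K -> J L) (g : J L ->
  J K).
Hypothesis fg : ref_pair K' L' f g.
Hypothesis gf : ref_pair L' K' g f.
Hypothesis redK : reduced K K'.
Hypothesis redL : reduced L L'.
Hypothesis p3 : (2 < p)%N.
Hypothesis q3 : (2 < q)%N.
Local Notation r i := (J_gen K i ^+ tnth K' i).
Local Notation r' j := (J_gen L j ^+ tnth L' j).

Let defK : defining_tuples K K'. Proof. by case: redK. Qed.
Let defL : defining_tuples L L'. Proof. by case: redL. Qed.

Lemma cut_order_counts m : (1 < m)%N ->
  #|[set i | cut_order K K' i == m]%SET| = #|[set j | cut_order L L' j == m]%SET|.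
Proof.
apply: (transfer_counts (transfers_cut_order fg gf redK redL)
  (transfers_cut_order gf fg redL redK) redK redL).
- by move=> i; apply: cut_order_gt0.
- by move=> j; apply: cut_order_gt0.
- by rewrite card_cut_order.
- by rewrite card_cut_order.
Qed.

Lemma ref_pair_length : p = q.
Proof.
by rewrite -(card_cut_order redK) (eq_card_gt1 cut_order_counts) card_cut_order.
Qed.

(** Killing the matched classes changes only the entries at [i] and [j]. On the side of [K] one
    occurrence of [c] disappears, so one disappears on the side of [L] too, and [j] has cut order
    [c] as well. Dividing by the common reflection order gives [k'_i = l'_j]. *)
Lemma matched_tuples i j : r i <> 1 -> matched K' L' f i j ->
  tnth K i = tnth L j /\ tnth K' i = tnth L' j.
Proof.
move=> ri ij; have rj := ij.1; have ji := matched_sym fg gf redK ri ij.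
have eq_refl := matched_refl_order fg gf redK redL ri ij.
have eq_quot := matched_quot_order fg gf redK redL ri ij.
suff k'l' : tnth K' i = tnth L' j.
  split=> //; move: eq_refl.
  case Ki: (tnth K i) => [k|]; case Lj: (tnth L j) => [l|] //.
  - have [a -> ->] := refl_order_Some defK Ki;
    have [b -> ->] := refl_order_Some defL Lj.
    by case=> ->; rewrite k'l'.
  - by have [a -> _] := refl_order_Some defK Ki; rewrite /refl_order Lj.
  - by have [a -> _] := refl_order_Some defL Lj; rewrite /refl_order Ki.
have tf := transfers_killed fg gf redK redL ri ij.
have tg := transfers_killed gf fg redL redK rj ji.
have leK := transfer_leq_gt1 tf tg redK redL (killed_gt0 redK _) (killed_gt0
  redL _).
have leL := transfer_leq_gt1 tg tf redL redK (killed_gt0 redL _) (killed_gt0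
  redK _).
have := card_killed redK p3 i; have := card_killed redL q3 j.
(* In the exceptional case on the side of [L], comparing the numbers of nontrivial orders puts [K]
   in the exceptional case too, and both entries are 1. *)
case: ltnP => [L3 _|L3 /= /andP[_ /eqP l'1]]; last first.
  case: ltnP => [K3 _|_ /= /andP[_ /eqP k'1]]; last by rewrite k'1 l'1.
  by have := leq_trans K3 (leK K3); rewrite ltnNge L3.
case: ltnP => [K3 _|K3]; last by have := leq_trans L3 (leL L3); rewrite ltnNge K3.
set c := cut_order K K' i; have c1 : (1 < c)%N by apply: cut_order_gt1.
have n1 : (1 < quot_order K K' i)%N by apply: quot_order_gt1.
have := cut_order_counts c1.
have := transfer_counts tf tg redK redL (killed_gt0 redK _) (killed_gt0 redL _)
  K3 L3 c1.
rewrite !card_sum !(bigD1 i (P := xpredT)) // !(bigD1 j (P := xpredT)) //=.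
have -> : (\sum_(i0 < p | i0 != i) (killed K K' i i0 == c)
    = \sum_(i0 < p | i0 != i) (cut_order K K' i0 == c))%N.
  by apply: eq_bigr => i0 ii0; rewrite killed_neq.
have -> : (\sum_(j0 < q | j0 != j) (killed L L' j j0 == c)
    = \sum_(j0 < q | j0 != j) (cut_order L L' j0 == c))%N.
  by apply: eq_bigr => j0 jj0; rewrite killed_neq.
have -> : (killed K K' i i == c) = false.
  rewrite killed_eq /c /cut_order -{1}[tnth K' i]muln1 eqn_pmul2l ?(ltn_eqF n1) //.
  by have [_ /(_ i)[]] := defK.
have -> : (cut_order K K' i == c) = true by apply: eqxx.
move=> cB cA; have cut_eq : cut_order L L' j = c.
  apply/eqP; move: cA; rewrite -[(\sum_(i0 < p | _) _)%N]/(false + \sum_(i0 < p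
    | i0 != i) (cut_order K K' i0 == c))%N cB addnA => /addIn.
  by case: (_ == c); case: (_ == c).
move: cut_eq; rewrite /c /cut_order -eq_quot => /eqP.
by rewrite eqn_pmul2r ?(ltnW n1) // => /eqP.
Qed.

Lemma leq_card_matched (P : pred 'I_p) (Q : pred 'I_q) :
  (forall i j, r i <> 1 -> matched K' L' f i j -> P i -> Q j) ->
  (#|[set i | (r i != 1%g) && P i]%SET| <= #|[set j | (r' j != 1%g) && Q j]%SET|)%N.
Proof.
move=> PQ; have q_gt0 : (0 < q)%N by do 2!apply: ltnW.
have /boolp.choice[s sP] : forall i, exists j, r i <> 1 -> matched K' L' f i j.
  move=> i; have [ri|ri] := pselect (r i = 1); first by exists (Ordinal q_gt0).
  by have [j ij] := exists_matched fg redL ri; exists j.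
rewrite -(card_in_imset (f := s)) => [|i i'].
  apply/subset_leq_card/fintype.subsetP=> _ /imsetP[i + ->].
  rewrite !finset.in_set => /andP[/eqP ri Pi]; have ij := sP _ ri.
  by rewrite (PQ _ _ ri ij Pi) andbT; apply/eqP; case: ij.
rewrite !finset.in_set => /andP[/eqP ri _] /andP[/eqP ri' _] ss.
have ij := sP _ ri; have ij' := sP _ ri'; rewrite -ss in ij'.
exact: (matched_back fg gf redK ri ij (matched_sym fg gf redK ri' ij')).
Qed.

End TwoSided.

Section Multisets.
Variables (p q : nat) (K : p.-tuple natoo) (K' : p.-tuple nat).
Variables (L : q.-tuple natoo) (L' : q.-tuple nat) (f : J K -> J L) (g : J L ->
  J K).
Hypothesis fg : ref_pair K' L' f g.
Hypothesis gf : ref_pair L' K' g f.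
Hypothesis redK : reduced K K'.
Hypothesis redL : reduced L L'.
Hypothesis p3 : (2 < p)%N.
Hypothesis q3 : (2 < q)%N.
Local Notation r i := (J_gen K i ^+ tnth K' i).
Local Notation r' j := (J_gen L j ^+ tnth L' j).

Lemma card_matched (P : pred 'I_p) (Q : pred 'I_q) :
  (forall i j, tnth K i = tnth L j -> tnth K' i = tnth L' j -> P i = Q j) ->
  #|[set i | (r i != 1%g) && P i]%SET| = #|[set j | (r' j != 1%g) && Q j]%SET|.
Proof.
move=> PQ; apply/eqP; rewrite eqn_leq; apply/andP; split.
  apply: (leq_card_matched fg gf) => // i j ri ij.
  by have [E E'] := matched_tuples fg gf redK redL p3 q3 ri ij; rewrite (PQ i j).
apply: (leq_card_matched gf fg) => // j i rj ji.
by have [E E'] := matched_tuples gf fg redL redK q3 p3 rj ji; rewrite -(PQ i j).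
Qed.

Lemma card_split (I : finType) (P Q : pred I) :
  #|[set i | Q i]%SET| = (#|[set i | P i && Q i]%SET| + #|[set i | ~~ P i && Q
    i]%SET|)%N.
Proof.
rewrite -(cardsID [set i | P i]%SET); congr (_ + _)%N; apply: eq_card => i.
  by rewrite !inE andbC.
by rewrite !inE.
Qed.

Lemma trivial_gen (n : nat) (M : n.-tuple natoo) (M' : n.-tuple nat) i :
  defining_tuples M M' -> J_gen M i ^+ tnth M' i = 1 ->
  tnth M i = Some (tnth M' i) /\ cut_order M M' i = tnth M' i.
Proof.
move=> def /(gen_eq1 def) r1; rewrite /cut_order /quot_order r1 muln1; split=> //.
move: r1; case Mi: (tnth M i) => [k|]; last by rewrite /refl_order Mi.
by have [a -> ->] := refl_order_Some def Mi => -[->]; rewrite muln1.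
Qed.

Lemma card_trivial_gen (n : nat) (M : n.-tuple natoo) (M' : n.-tuple nat) a b :
  defining_tuples M M' ->
  #|[set i | ~~ (J_gen M i ^+ tnth M' i != 1%g)
             && ((tnth M i == a) && (tnth M' i == b))]%SET|
  = if a == Some b then #|[set i | ~~ (J_gen M i ^+ tnth M' i != 1%g)
             && (cut_order M M' i == b)]%SET| else 0%N.
Proof.
move=> def; case: ifP => ab; last first.
  apply/eqP; rewrite cards_eq0; apply/eqP/setP=> i; rewrite !finset.in_set negbK.
  apply/negP=> /and3P[/eqP r1 /eqP Mi /eqP M'i]; move: ab.
  by have [E _] := trivial_gen def r1; rewrite -Mi E M'i eqxx.
apply: eq_card => i; rewrite !finset.in_set negbK; case: eqP => //= r1.
have [-> ->] := trivial_gen def r1; rewrite (eqP ab).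
by rewrite (inj_eq Some_inj) andbb.
Qed.

(** The matching counts the nontrivial [r i]. A trivial one has [k_i = k'_i], equal to its cut
    order, so it is counted by what the matching leaves of the multiset of cut orders. *)
Lemma pair_counts (a : natoo) (b : nat) :
  #|[set i | (tnth K i == a) && (tnth K' i == b)]%SET|
  = #|[set j | (tnth L j == a) && (tnth L' j == b)]%SET|.
Proof.
have [defK _ _] := redK; have [defL _ _] := redL.
rewrite (card_split (fun i => r i != 1%g)) [RHS](card_split (fun j => r' j != 1%g)).
congr (_ + _)%N; first by apply: card_matched => i j -> ->.
rewrite !card_trivial_gen //; case: ifP => // _.
have [b1|b1] := leqP b 1.
  have zero (n : nat) (M : n.-tuple natoo) (M' : n.-tuple nat) (P : pred 'I_n) :
      defining_tuples M M' -> #|[set i | P i && (cut_order M M' i == b)]%SET| = 0%N.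
    move=> def; apply/eqP; rewrite cards_eq0; apply/eqP/setP=> i.
    rewrite !finset.in_set; apply/negP=> /andP[_ /eqP ib].
    by have := cut_order_gt1 def i; rewrite ib ltnNge b1.
  by rewrite !zero.
have := cut_order_counts fg gf redK redL p3 q3 b1.
rewrite (card_split (fun i => r i != 1%g)) [RHS](card_split (fun j => r' j != 1%g)).
rewrite (card_matched (Q := fun j => cut_order L L' j == b)); first exact: addnI.
by move=> i j E E'; rewrite /cut_order /quot_order /refl_order E E'.
Qed.

End Multisets.

Lemma ref_iso_permutation p q (K : p.-tuple natoo) (K' : p.-tuple nat)
    (L : q.-tuple natoo) (L' : q.-tuple nat) :
  reduced K K' -> reduced L L' -> (2 < p)%N -> (2 < q)%N -> ref_iso K K' L L' ->
  p = q /\ exists s : 'S_p,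
    permt s K = L :> seq natoo /\ permt s K' = L' :> seq nat.
Proof.
move=> redK redL p3 q3 /ref_iso_pair[f [g [fg gf]]].
have pq := ref_pair_length fg gf redK redL p3 q3; split=> //.
have cnt := pair_counts fg gf redK redL p3 q3.
case: q / pq L L' cnt {redL q3 f g fg gf} => L L' cnt.
(* A single permutation has to serve both tuples, hence the pairs. *)
pose u := [tuple (tnth K i, tnth K' i) | i < p].
pose v := [tuple (tnth L i, tnth L' i) | i < p].
have cnt_mem (M : p.-tuple natoo) (M' : p.-tuple nat) a b :
    count_mem (a, b) [tuple (tnth M i, tnth M' i) | i < p]
    = #|[set i | (tnth M i == a) && (tnth M' i == b)]%SET|.
  rewrite /= count_map -size_filter cardE; congr size.
  rewrite enumT /enum_mem; apply: eq_filter => i /=.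
  by rewrite finset.in_set.
have : perm_eq v u.
  by apply/allP=> -[a b] _ /=; rewrite !cnt_mem cnt.
case/tuple_permP=> s vE; exists s.
have {}vE i : (tnth L i, tnth L' i) = (tnth K (s i), tnth K' (s i)).
  have := congr1 (fun t : seq _ => nth (None, 0%N) t i) vE.
  by rewrite -!tnth_nth !tnth_mktuple.
by split; congr (tval _); apply: eq_from_tnth => i; rewrite tnth_mktuple;
  case: (vE i).
Qed.

End Recovery.

(** * Permuting the generators, and the abelian case *)

Section RefIsoLaws.
Local Open Scope group_scope.

Lemma ref_pair_comp p q n (K : p.-tuple natoo) (K' : p.-tuple nat)
    (L : q.-tuple natoo) (L' : q.-tuple nat) (M : n.-tuple natoo) (M' :
      n.-tuple nat)
    (f : J K -> J L) (g : J L -> J K) (f' : J L -> J M) (g' : J M -> J L) :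
  ref_pair K' L' f g -> ref_pair L' M' f' g' -> ref_pair K' M' (f' \o f) (g \o g').
Proof.
move=> [fM fW gf fR] [f'M f'W g'f' f'R]; split=> [x y Wx Wy|x Wx|x Wx|x Rx] /=.
- by rewrite fM // f'M //; apply: fW.
- by apply: f'W; apply: fW.
- by rewrite g'f' ?gf //; apply: fW.
- by apply: f'R; apply: fR.
Qed.

Lemma ref_iso_trans p q n (K : p.-tuple natoo) (K' : p.-tuple nat)
    (L : q.-tuple natoo) (L' : q.-tuple nat) (M : n.-tuple natoo) (M' :
      n.-tuple nat) :
  ref_iso K K' L L' -> ref_iso L L' M M' -> ref_iso K K' M M'.
Proof.
move=> /ref_iso_pair[f [g [fg gf]]] /ref_iso_pair[f' [g' [fg' gf']]].
exact: ref_pair_iso (ref_pair_comp fg fg') (ref_pair_comp gf' gf).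
Qed.

Lemma ref_iso_sym p q (K : p.-tuple natoo) (K' : p.-tuple nat)
    (L : q.-tuple natoo) (L' : q.-tuple nat) :
  ref_iso K K' L L' -> ref_iso L L' K K'.
Proof. by move=> /ref_iso_pair[f [g [fg gf]]]; apply: ref_pair_iso gf fg. Qed.

Lemma ref_pair_morph p q (K : p.-tuple natoo) (K' : p.-tuple nat)
    (L : q.-tuple natoo) (L' : q.-tuple nat) (f : J K -> J L) (g : J L -> J K) :
  {morph f : x y / x * y} -> cancel f g ->
  (forall i, exists j w, f (J_gen K i) = J_gen L j ^ w /\ tnth K' i = tnth L' j) ->
  ref_pair K' L' f g.
Proof.
move=> fM fK fgen.
have f_inj := can_inj fK.
split=> [x y _ _|||r [i [t [h [[n tn] t1 ->]]]]]; [exact: fM| |by move=> x _;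
  apply: fK|].
  apply: generalized_J_min => [|i].
    split=> [|x y Wx Wy|x Wx|x h Wx].
    - by rewrite (morph_one fM); apply: generalized_J1.
    - by rewrite fM; apply: generalized_JM.
    - by rewrite (morph_inv fM); apply: generalized_JV.
    - by rewrite (morph_conj fM); apply: generalized_JJ.
  have [j [w [E E']]] := fgen i.
  rewrite (morph_exp fM) E -conjXg E'; apply: generalized_JJ.
  exact: generalized_J_gen.
have [j [w [E E']]] := fgen i.
pose u := J_gen L j ^+ tnth L' j.
have ftE : exists2 v, powers u v & f t = v ^ w.
  case: tn => ->; [exists (u ^+ n)|exists (u ^- n)]; try by exists n; [left|right].
  - by exists n; left.
  - by rewrite !(morph_exp fM) E E' !conjXg.
  - by exists n; right.
  - by rewrite (morph_inv fM) !(morph_exp fM) E E' conjVg !conjXg.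
have [v uv fv] := ftE; exists j, v, (w * f h); split=> //.
  by move=> v1; apply: t1; apply: f_inj; rewrite fv v1 conj1g (morph_one fM).
by rewrite (morph_conj fM) fv conjgM.
Qed.

End RefIsoLaws.

Section Permutations.
Local Open Scope group_scope.

Lemma prod_adjacent (G : groupType) p (h t : 'I_p -> G) (a b : 'I_p) :
  b = a.+1 :> nat -> (forall i, i != a -> i != b -> h i = t i) ->
  h a * h b = t a * t b -> \prod_(i < p) h i = \prod_(i < p) t i.
Proof.
move=> ba ht hab; pose H n := oapp h 1 (insub n); pose T n := oapp t 1 (insub n).
have HE (i : 'I_p) : H i = h i by rewrite /H valK.
have TE (i : 'I_p) : T i = t i by rewrite /T valK.
under eq_bigr => i _ do rewrite -HE; under [RHS]eq_bigr => i _ do rewrite -TE.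
rewrite -(big_mkord xpredT H) -(big_mkord xpredT T).
have HT (n : nat) : n != a -> n != b -> H n = T n.
  rewrite /H /T; case: insubP => [i _ <-|//] ia ib /=; exact: ht.
have bp := ltn_ord b; have ap := ltn_ord a.
rewrite !(big_cat_nat (n := a) (leq0n a) (ltnW ap)) /=.
rewrite !(big_ltn ap) -ba !(big_ltn bp) !HE !TE; congr (_ * _).
  apply: eq_big_nat => n /andP[_ na]; apply: HT; rewrite ltn_eqF //.
  by rewrite ba ltnW.
rewrite !mulgA hab; congr (_ * _); apply: eq_big_nat => n /andP[bn _].
by apply: HT; rewrite gtn_eqF // ltnW // -ba.
Qed.

(** The Hurwitz move preserves the product of the two neighbours and with it [z]. It is an
    isomorphism of the whole groups that sends generators to conjugates of generators, so it
    respects reflections. *)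
Lemma ref_iso_adjacent p (K : p.-tuple natoo) (K' : p.-tuple nat) (a b : 'I_p) :
  b = a.+1 :> nat -> ref_iso K K' (permt (tperm a b) K) (permt (tperm a b) K').
Proof.
move=> ba; set L := permt _ K; set L' := permt _ K'.
have ab : a != b by rewrite -val_eqE /= ba ltn_eqF.
pose s := J_gen K; pose t := J_gen L.
pose h i := if i == a then t b ^ (t a)^-1 else if i == b then t a else t i.
pose m i := if i == a then s b else if i == b then s a ^ s b else s i.
have LE i : tnth L i = tnth K (tperm a b i) by rewrite tnth_mktuple.
have L'E i : tnth L' i = tnth K' (tperm a b i) by rewrite tnth_mktuple.
have hprod : \prod_(i < p) h i = J_center L.
  apply: (prod_adjacent ba) => [i ia ib|].
    by rewrite /h (negPf ia) (negPf ib).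
  by rewrite /h !eqxx eq_sym (negPf ab) conjgE invgK !mulgA mulgVK.
have mprod : \prod_(i < p) m i = J_center K.
  apply: (prod_adjacent ba) => [i ia ib|].
    by rewrite /m (negPf ia) (negPf ib).
  by rewrite /m !eqxx eq_sym (negPf ab) conjgE mulVKg.
have hz i : commute (\prod_(j < p) h j) (h i) by rewrite hprod; apply: J_centerC.
have mz i : commute (\prod_(j < p) m j) (m i) by rewrite mprod; apply: J_centerC.
have hgen i : exists j w, h i = t j ^ w /\ tperm a b j = i.
  rewrite /h; case: eqP => [->|/eqP ia]; first by exists b, (t a)^-1;
    rewrite tpermR.
  case: eqP => [->|/eqP ib]; first by exists a, 1; rewrite conjg1 tpermL.
  by exists i, 1; rewrite conjg1 tpermD // eq_sym.
have mgen i : exists j w, m i = s j ^ w /\ tperm a b i = j.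
  rewrite /m; case: eqP => [->|/eqP ia]; first by exists b, 1;
    rewrite conjg1 tpermL.
  case: eqP => [->|/eqP ib]; first by exists a, (s b); rewrite tpermR.
  by exists i, 1; rewrite conjg1 tpermD // eq_sym.
have hk i n : tnth K i = Some n -> h i ^+ n = 1.
  move=> Ki; have [j [w [-> ij]]] := hgen i.
  by rewrite -conjXg J_gen_exp ?conj1g // LE ij.
have mk i n : tnth L i = Some n -> m i ^+ n = 1.
  rewrite LE => Li; have [j [w [-> ij]]] := mgen i.
  by rewrite -conjXg J_gen_exp ?conj1g // -ij.
pose f : J K -> J L := J_lift h; pose g : J L -> J K := J_lift m.
have fM : {morph f : x y / x * y} := J_liftM hz hk.
have gM : {morph g : x y / x * y} := J_liftM mz mk.
have fs i : f (s i) = h i := J_lift_gen hz hk i.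
have gt i : g (t i) = m i := J_lift_gen mz mk i.
have fK : cancel f g.
  apply: (J_morph_eq (f := g \o f) (g := id)) => // [x y|i] /=;
    first by rewrite fM gM.
  rewrite fs /h; case: eqP => [->|/eqP ia].
    by rewrite (morph_conj gM) (morph_inv gM) !gt /m !eqxx eq_sym (negPf ab) conjgK.
  case: eqP => [->|/eqP ib]; first by rewrite gt /m eqxx.
  by rewrite gt /m (negPf ia) (negPf ib).
have gK : cancel g f.
  apply: (J_morph_eq (f := f \o g) (g := id)) => // [x y|i] /=;
    first by rewrite gM fM.
  rewrite gt /m; case: eqP => [->|/eqP ia].
    by rewrite fs /h eqxx eq_sym (negPf ab).
  case: eqP => [->|/eqP ib].
    by rewrite (morph_conj fM) !fs /h !eqxx eq_sym (negPf ab) conjgKV.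
  by rewrite fs /h (negPf ia) (negPf ib).
apply: (ref_pair_iso (f := f) (g := g)); apply: ref_pair_morph => // i.
  by have [j [w [E ij]]] := hgen i; exists j, w; rewrite fs L'E ij.
by have [j [w [E ij]]] := mgen i; exists j, w; rewrite gt L'E ij.
Qed.

Lemma permtM (T : Type) p (s u : 'S_p) (v : p.-tuple T) :
  permt s (permt u v) = permt (s * u) v.
Proof. by apply: eq_from_tnth => i; rewrite !tnth_mktuple permM. Qed.

Lemma permt1 (T : Type) p (v : p.-tuple T) : permt 1 v = v.
Proof. by apply: eq_from_tnth => i; rewrite tnth_mktuple perm1. Qed.

Definition ref_perm p (s : 'S_p) : Prop :=
  forall (K : p.-tuple natoo) (K' : p.-tuple nat), ref_iso K K' (permt s K)
    (permt s K').

Lemma ref_permM p (s u : 'S_p) : ref_perm s -> ref_perm u -> ref_perm (s * u).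
Proof.
move=> Hs Hu K K'; rewrite -!permtM.
exact: ref_iso_trans (Hu _ _) (Hs _ _).
Qed.

Lemma ref_perm1 p : ref_perm (1 : 'S_p).
Proof.
move=> K K'; rewrite !permt1.
have pid : ref_pair K' K' id (@id (J K)) by split.
exact: (ref_pair_iso pid pid).
Qed.

Lemma ref_perm_tperm p (a b : 'I_p) : ref_perm (tperm a b).
Proof.
wlog ab : a b / (a < b)%N.
  move=> H; have [/H//|/H|/val_inj ->] := ltngtP a b; first by rewrite tpermC.
  by rewrite tperm1; apply: ref_perm1.
have [n nE] : exists n, (n = b - a)%N by exists (b - a)%N.
elim: n => [|n IHn] in b ab nE *.
  by move: ab; rewrite -subn_gt0 -nE.
have [n0|n0] := posnP n.
  move=> K K'; apply: ref_iso_adjacent.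
  by rewrite -(subnK (ltnW ab)) -nE n0 add1n.
have bp : (b.-1 < p)%N by apply: leq_ltn_trans (leq_pred _) (ltn_ord b).
pose c := Ordinal bp.
have b_gt0 : (0 < b)%N by apply: leq_ltn_trans ab.
have bc : b = c.+1 :> nat by rewrite /= prednK.
have ac : (a < c)%N by rewrite /= -subn_gt0 -subn1 -subnDA addnC subnDA -nE subn1.
have nc : n = (c - a)%N by rewrite /= -subn1 -subnDA addnC subnDA -nE subn1.
have adj : ref_perm (tperm c b) by move=> K K'; apply: ref_iso_adjacent.
have -> : tperm a b = tperm c b * (tperm a c * tperm c b).
  rewrite -[X in _ = X * _](tpermV c b) -conjgE tpermJ tpermL tpermD //.
    by rewrite -val_eqE gtn_eqF.
  by rewrite -val_eqE gtn_eqF.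
by apply: ref_permM => //; apply: ref_permM => //; apply: IHn.
Qed.

Lemma ref_perm_all p (s : 'S_p) : ref_perm s.
Proof.
have [ts -> _] := prod_tpermP s.
elim: ts => [|u ts IHts]; first by rewrite big_nil; apply: ref_perm1.
by rewrite big_cons; apply: ref_permM => //; apply: ref_perm_tperm.
Qed.

End Permutations.

Section Abelian.
Local Open Scope group_scope.

(** If [W] were abelian, [J K] would be, being generated by [W] and central elements. In the
    reflection representation, with infinite entries replaced by 2, the element [x i0] would then
    commute with all [x j], against its order modulo scalars. *)
Lemma nonabelian_J p (K : p.-tuple natoo) (K' : p.-tuple nat) :
  reduced K K' -> (2 < p)%N -> ~ abelian_J K K'.
Proof.
move=> red p3 abW; have [[_ def] _ _] := red.
have abG (x y : J K) : commute x y.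
  have [w [c [Ww Zc ->]]] := generalized_J_decomp x red.
  apply/commute_sym/commuteM; last by apply/commute_sym/Zc.1.
  have [v [d [Wv Zd ->]]] := generalized_J_decomp y red.
  apply/commute_sym/commuteM; last by apply/commute_sym/Zd.1.
  exact: abW.
pose k i := odflt 2 (tnth K i).
have k1 i : (1 < k i)%N by have [+ _ _] := def i; rewrite /k; case: (tnth K i).
have k3 : (2 < #|[set i | 1 < k i]%N%SET|)%N.
  rewrite (_ : [set i | _]%SET = finset.setT) ?cardsT ?card_ord //.
  by apply/setP=> i; rewrite !finset.in_set k1.
have [gT [x [xk xz xC]]] := reflection_rep (fun i => ltnW (k1 i)) k3.
have xk' i n : tnth K i = Some n -> x i ^+ n = 1.
  by move=> Ki; have := xk i; rewrite /k Ki.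
pose i0 : 'I_p := Ordinal (ltnW (ltnW p3)).
have := xC i0 1%N; rewrite dvdn1 expg1 => xC0.
have := k1 i0; rewrite (eqP (xC0 _)) // => j.
rewrite -(J_lift_gen xz xk' i0) -(J_lift_gen xz xk' j) /commute -!(J_liftM xz xk').
by congr J_lift; apply: abG.
Qed.

Lemma commutative_J p (K : p.-tuple natoo) : (p <= 2)%N -> forall x y : J K,
  commute x y.
Proof.
move=> p2; suff gC i j : commute (J_gen K i) (J_gen K j).
  have gxC i x : commute (J_gen K i) x.
    elim/J_ind: x => [|x y|x|//]; [exact: commute1|exact: commuteM|exact: commuteV].
  move=> x y; elim/J_ind: y => [|y z|y|i];
    [exact: commute1|exact: commuteM|exact: commuteV|].
  exact/commute_sym/gxC.
wlog ij : i j / (i < j)%N.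
  by move=> H; have [/H//|/H/commute_sym//|/val_inj ->] := ltngtP i j.
have i0 : i = 0%N :> nat by apply/eqP;
  rewrite -leqn0 -ltnS (leq_trans ij) // -ltnS (leq_trans (ltn_ord j)).
have j1 : j = 1%N :> nat by apply/eqP;
  rewrite eqn_leq -ltnS (leq_trans (ltn_ord j)) // -i0.
have pE : p = 2 by apply/eqP; rewrite eqn_leq p2; have := ltn_ord j; rewrite j1.
have zE : J_center K = J_gen K i * J_gen K j.
  move: i j i0 j1 {ij}; rewrite /J_center.
  move: K; rewrite pE => M i j i0 j1; rewrite !big_ord_recl big_ord0 mulg1.
  by congr (J_gen _ _ * J_gen _ _); apply: val_inj; rewrite /= ?i0 ?j1.
have := J_centerC (J_gen K i); rewrite zE /commute -[LHS]mulgA => /mulgI/esym.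
exact.
Qed.

(** * Groups with at most two generators *)

Section SmallRank.
Variables (p : nat) (K : p.-tuple natoo) (K' : p.-tuple nat).
Hypothesis def : defining_tuples K K'.
Hypothesis p2 : (p <= 2)%N.

(** Entries of [L] can be 1, so [L] and [L'] need not be defining tuples; the exact orders are taken
    from the side of [K]. *)
Let L : p.-tuple natoo := [tuple divoo (tnth K i) (tnth K' i) | i < p].
Let L' : p.-tuple nat := [tuple 1%N | i < p].
Local Notation r i := (J_gen K i ^+ tnth K' i).

Let cK (x y : J K) : commute x y. Proof. exact: commutative_J. Qed.
Let cL (x y : J L) : commute x y. Proof. exact: commutative_J. Qed.

Let LE i : tnth L i = refl_order K K' i. Proof. by rewrite tnth_mktuple. Qed.

Let rL i n : tnth L i = Some n -> r i ^+ n = 1.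
Proof. by rewrite LE => E; apply/(gen_power_eq1 def); rewrite E. Qed.

Let rz i : commute (\prod_(j < p) r j) (r i). Proof. exact: cK. Qed.

Let phi : J L -> J K := J_lift (fun i => r i).

Let phiM : {morph phi : x y / x * y}. Proof. exact: J_liftM rz rL. Qed.

Let phi_gen i : phi (J_gen L i) = r i. Proof. exact: J_lift_gen rz rL i. Qed.

(** Natural exponents on both sides take the place of integer exponents. *)
Let normal_form (y : J L) : exists u v : 'I_p -> nat,
  y * \prod_(i < p) J_gen L i ^+ v i = \prod_(i < p) J_gen L i ^+ u i.
Proof.
have prodD u v : \prod_(i < p) J_gen L i ^+ (u i + v i) =
    (\prod_(i < p) J_gen L i ^+ u i) * \prod_(i < p) J_gen L i ^+ v i.
  by rewrite -prodgM_commute //; apply: eq_bigr => i _; rewrite expgnDr.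
have prod0 : \prod_(i < p) J_gen L i ^+ 0 = 1 by apply: big1.
elim/J_ind: y => [|x y [u [v E]] [u' [v' E']]|x [u [v E]]|i].
- by exists (fun=> 0%N), (fun=> 0%N); rewrite mul1g.
- exists (fun i => u i + u' i)%N, (fun i => v i + v' i)%N.
  by rewrite !prodD -E -E' -!mulgA; congr (_ * _); rewrite !mulgA (cL y).
- by exists v, u; rewrite -E mulKg.
exists (fun j => (j == i) : nat), (fun=> 0%N); rewrite prod0 mulg1.
rewrite (eq_bigr (fun j => if j == i then J_gen L j else 1)) => [|j _].
  by rewrite -big_mkcond big_pred1_eq.
by case: eqP.
Qed.

(** The characters of [J K] at [i] recover the exponent at [i] of a product of powers of the [r j],
    up to the order of [r i]; the generator of [J L] is killed by this order. *)
Let phi_inj : injective phi.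
Proof.
pose P (u : 'I_p -> nat) := \prod_(i < p) J_gen L i ^+ u i.
have P_inj u v i : phi (P u) = phi (P v) -> J_gen L i ^+ u i = J_gen L i ^+ v i.
  wlog uv : u v / (v i <= u i)%N.
    move=> H E; have [vu|/ltnW uv] := leqP (v i) (u i); first exact: H.
    exact/esym/H.
  move=> E; have : r i ^+ (u i - v i) = 1.
    rewrite -expgnA; apply: J_gen_exp_characters => [k|m m0 mK];
      first exact: (tuple_gt0 def).
    have [A [chi [chiM chiC chi0 chi1]]] := J_character m0 mK.
    have chiP w : chi (phi (P w)) = chi (r i) ^+ w i.
      rewrite (morph_bigprod phiM) (morph_bigprod chiM).
      rewrite (eq_bigr (fun j => if j == i then chi (r j) ^+ w j else 1)) => [|j _].
        by rewrite -big_mkcond big_pred1_eq.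
      rewrite (morph_exp phiM) phi_gen (morph_exp chiM); case: eqP => [//|/eqP ji].
      by rewrite (morph_exp chiM) chi0 // !expg1n.
    have := congr1 chi E; rewrite !chiP (morph_exp chiM) -!expgnA => uvE.
    by rewrite -chi1 mulnBr expgnFr ?leq_mul2l ?uv ?orbT // uvE mulgV.
  move/(gen_power_eq1 def); rewrite -LE => uvE.
  have : J_gen L i ^+ (u i - v i) = 1.
    move: uvE; case Li: (tnth L i) => [a|]; last by move/eqP->.
    by case/dvdnP=> m ->; rewrite mulnC expgnA (J_gen_exp Li) expg1n.
  by rewrite expgnFr // => /divg1_eq.
have phi1 y : phi y = 1 -> y = 1.
  have [u [v E]] := normal_form y => phiy.
  have uv : P v = P u.
    apply: eq_bigr => i _; apply: P_inj.
    by rewrite -[X in _ = phi X]E phiM phiy mul1g.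
  by apply: (mulIg (P v)); rewrite mul1g E.
move=> x y xy; apply: divg1_eq; apply: phi1.
by rewrite phiM (morph_inv phiM) xy mulgV.
Qed.

Lemma small_rank_ref_iso : ref_iso K K' L L'.
Proof.
apply: ref_iso_sym.
have WL y : generalized_J L L' y.
  elim/J_ind: y => [|x y|x|i].
  - exact: generalized_J1.
  - exact: generalized_JM.
  - exact: generalized_JV.
  by apply: (generalized_J_gen_dvd (i := i) (n := 1)); rewrite tnth_mktuple.
have WphiK y : generalized_J K K' (phi y).
  elim/J_ind: y => [|x y Wx Wy|x Wx|i].
  - by rewrite (morph_one phiM); apply: generalized_J1.
  - by rewrite phiM; apply: generalized_JM.
  - by rewrite (morph_inv phiM); apply: generalized_JV.
  by rewrite phi_gen; apply: generalized_J_gen.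
have conjK (x h : J K) : x ^ h = x by rewrite conjgE (cK x h) mulKg.
exists phi; split=> //.
  split=> [y _|x y _ _|x]; [exact: WphiK|exact: phi_inj|].
  move=> Wx; suff [y <-] : exists y, phi y = x by exists y.
  move: x Wx; apply: generalized_J_min => [|i]; last by exists (J_gen L i).
  split=> [|x y [u <-] [v <-]|x [u <-]|x h [u <-]].
  - by exists 1; rewrite (morph_one phiM).
  - by exists (u * v).
  - by exists u^-1; rewrite (morph_inv phiM).
  - by exists u; rewrite conjK.
apply/seteqP; split=> [_ [_ [i [t [h [[n tn] t1 ->]]]] <-]|_ [i [t [h [[n tn]
  t1 ->]]]]].
  have phit : powers (r i) (phi t).
    rewrite tnth_mktuple expg1 in tn; exists n.
    by case: tn => ->; rewrite ?(morph_inv phiM) (morph_exp phiM) phi_gen;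
      [left|right].
  exists i, (phi t), (phi h); split=> //; last by rewrite (morph_conj phiM).
  by move=> phit1; apply: t1; apply: phi_inj; rewrite phit1 (morph_one phiM).
have [u tu phiu] : exists2 u, powers (J_gen L i ^+ tnth L' i) u & phi u = t.
  rewrite tnth_mktuple expg1; case: tn => ->.
    by exists (J_gen L i ^+ n); [exists n; left|rewrite (morph_exp phiM) phi_gen].
  exists (J_gen L i ^- n); first by exists n; right.
  by rewrite (morph_inv phiM) (morph_exp phiM) phi_gen.
exists u; last by rewrite conjK.
exists i, u, 1; split=> //; last by rewrite conjg1.
by move=> u1; apply: t1; rewrite -phiu u1 (morph_one phiM).
Qed.

End SmallRank.

Lemma abelian_JP p (K : p.-tuple natoo) (K' : p.-tuple nat) :
  reduced K K' -> abelian_J K K' <-> (p <= 2)%N.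
Proof.
move=> red; split=> [abW|p2 x y _ _]; last exact: commutative_J.
by rewrite leqNgt; apply/negP=> p3; apply: (nonabelian_J red p3).
Qed.

End Abelian.

Theorem proposition1p11 (p q : nat)
    (K : p.-tuple natoo) (K' : p.-tuple nat)
    (L : q.-tuple natoo) (L' : q.-tuple nat)
    (redW1 : reduced K K') (redW2 : reduced L L') :
  ((abelian_J K K' <-> p <= 2) /\
   (p = 1 ->
      ref_iso K K' [tuple divoo (nth None K 0) (nth 0 K' 0)] [tuple 1]) /\
   (p = 2 ->
      ref_iso K K'
        [tuple divoo (nth None K 0) (nth 0 K' 0);
               divoo (nth None K 1) (nth 0 K' 1)] [tuple 1; 1])) /\
  (~ abelian_J K K' -> ~ abelian_J L L' ->
     (ref_iso K K' L L' <->
      p = q /\ exists s : 'S_p,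
        (permt s K = L :> seq natoo) /\ (permt s K' = L' :> seq nat))).
Proof.
(* Only the entries of [N] and [N'] are prescribed, so that the explicit tuples of length 1 and 2
   can be checked entry by entry. *)
have small n (M : n.-tuple natoo) (M' : n.-tuple nat) N N' :
    reduced M M' -> n <= 2 ->
    (forall i, tnth N i = divoo (tnth M i) (tnth M' i)) -> (forall i, tnth N' i
      = 1) ->
    ref_iso M M' N N'.
  move=> [def _ _] n2 NE N'E.
  have -> : N = [tuple divoo (tnth M i) (tnth M' i) | i < n].
    by apply: eq_from_tnth => i; rewrite tnth_mktuple.
  have -> : N' = [tuple 1 | i < n].
    by apply: eq_from_tnth => i; rewrite tnth_mktuple.
  exact: small_rank_ref_iso.
split.
  split; first exact: abelian_JP.
  split=> pE; case: _ / (esym pE) K K' redW1 => M M' red; apply: small => // i.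
  - by rewrite (ord1 i) !(tnth_nth 0) !(tnth_nth None).
  - by rewrite (ord1 i).
  - by rewrite !(tnth_nth None) (tnth_nth 0); case: i => -[|[|//]].
  - by rewrite (tnth_nth 0); case: i => -[|[|//]].
move=> nabW1 nabW2; split.
  apply: ref_iso_permutation => //.
    by rewrite ltnNge; apply/negP=> /(abelian_JP redW1).
  by rewrite ltnNge; apply/negP=> /(abelian_JP redW2).
case=> pq [s [sK sK']]; case: q / pq L L' {redW2 nabW2} sK sK' => L L' sK sK'.
by rewrite -(val_inj sK) -(val_inj sK'); apply: ref_perm_all.
Qed.
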